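(* Let $\mathcal{H}$ be a Hilbert space of finite dimension $N\geqslant1$, and let $\tilde u=(u,\varphi)$ and $\tilde v=(v,\psi)$ be elements of $\widetilde{\mathrm{U}}(\mathcal{H})$. With $d$, $\tilde d$ and $m$ as defined in the context: 1. If $\tilde d(\tilde u,\tilde v)\leqslant\dfrac{\pi}{2N}$, then $\tilde d(\tilde u,\tilde v)=d(u,v)=m$. 2. $\dfrac{|\psi-\varphi|}{N}\leqslant\tilde d(\tilde u,\tilde v)\leqslant\dfrac{|\psi-\varphi|}{N}+2\pi.$
   Context: $\mathrm{U}(\mathcal{H})$ is the unitary group and $\|\cdot\|$ the operator norm. The length of a piecewise $C^1$ curve $\gamma:[a,b]\to\mathrm{U}(\mathcal{H})$ is $\int_a^b\|\gamma'(t)\|\,dt$, and $d(u,v)$ is the infimum of lengths of curves in $\mathrm{U}(\mathcal{H})$ with endpoints $u,v$. The universal cover is realised as $\widetilde{\mathrm{U}}(\mathcal{H})=\{(u,\varphi)\in\mathrm{U}(\mathcal{H})\times\mathbb{R}:\det u=e^{i\varphi}\}$; the length of a curve $(\gamma(t),\varphi(t))$ in it is $\int_a^b\|\gamma'(t)\|dt$, and $\tilde d(\tilde u,\tilde v)$ is the infimum of the lengths of piecewise $C^1$ curves in $\widetilde{\mathrm{U}}(\mathcal{H})$ joining $\tilde u$ to $\tilde v$. Given $\tilde u=(u,\varphi)$, $\tilde v=(v,\psi)$, let $\lambda_1,\dots,\lambda_N$ be the eigenvalues of $vu^{-1}$ (with multiplicity), let $$R=\Bigl\{\theta\in\mathbb{R}^N:\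 e^{i\theta_i}=\lambda_i\ \forall i,\ \text{ and }\ \sum_{i=1}^N\theta_i=\psi-\varphi\Bigr\},$$ and $m=\min\bigl\{\max_{i=1,\dots,N}|\theta_i|:\theta\in R\bigr\}$. *)

(* Defs.v *)
From HB Require Import structures.
From mathcomp Require Import all_boot all_order all_algebra.
From mathcomp Require Import all_classical all_reals all_analysis.
From mathcomp Require Import complex.

Set Implicit Arguments.
Unset Strict Implicit.
Unset Printing Implicit Defensive.

Import Order.TTheory GRing.Theory Num.Theory Num.Def.
Import numFieldNormedType.Exports.
Import ComplexField.Normc.
Local Open Scope classical_set_scope.
Local Open Scope ring_scope.
Local Open Scope complex_scope.

Section hilbert_norm.
Context {R : realType} {H : vectType R[i]}.
Variable dot : {dot H for conjC}.

Definition hnorm (x : H) : R := Num.sqrt (complex.Re (dot x x)).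

Definition opnorm (f : 'End(H)) : R :=
  sup [set hnorm (f x) | x in [set x | hnorm x <= 1]].

Lemma hnorm_sqrtC x : (hnorm x)%:C = sqrtC (dot x x).
Proof.
have d0 : 0 <= dot x x by exact: dnorm_ge0.
apply/eqP; rewrite -(@eqrXn2 _ 2)//; last 2 first.
- by rewrite lecE /= eqxx sqrtr_ge0.
- by rewrite sqrtC_ge0.
rewrite sqrtCK -rmorphXn/= sqr_sqrtr ?RRe_real//.
  by rewrite ger0_real.
by move: d0; rewrite lecE/= => /andP[].
Qed.

Lemma hnorm_ge0 x : 0 <= hnorm x. Proof. exact: sqrtr_ge0. Qed.

Lemma hnorm0 : hnorm 0 = 0.
Proof. by rewrite /hnorm linear0r /= sqrtr0. Qed.

Lemma hnorm_eq0 x : hnorm x = 0 -> x = 0.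
Proof.
move=> h; apply/eqP; rewrite -(sqrt_dnorm_eq0 dot) -hnorm_sqrtC h.
by rewrite rmorph0.
Qed.

Lemma hnormD x y : hnorm (x + y) <= hnorm x + hnorm y.
Proof.
by rewrite -lecR rmorphD/= !hnorm_sqrtC (triangle_lerif dot x y).
Qed.

Lemma hnormZ (a : R[i]) x : hnorm (a *: x) = normc a * hnorm x.
Proof.
apply/(@complexI R); rewrite rmorphM/= !hnorm_sqrtC dnormZ.
by rewrite sqrtCM ?nnegrE ?exprn_ge0 ?dnorm_ge0// sqrCK.
Qed.

Lemma hnorm_sum (I : Type) (r : seq I) (P : pred I) (F : I -> H) :
  hnorm (\sum_(i <- r | P i) F i) <= \sum_(i <- r | P i) hnorm (F i).
Proof.
elim/big_ind2 : _ => [|x a y b xa yb|//]; first by rewrite hnorm0.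
by rewrite (le_trans (hnormD _ _))// lerD.
Qed.

Lemma normc_dot_le x y : normc (dot x y) <= hnorm x * hnorm y.
Proof.
rewrite -lecR rmorphM/= !hnorm_sqrtC.
exact: (CauchySchwarz_sqrt dot x y).
Qed.

Lemma orthonormal_basis :
  exists e : seq H, orthonormal dot e /\ basis_of fullv e.
Proof.
suff /(_ (\dim {:H}) (leqnn _)) [e [se oe]] : forall k, (k <= \dim {:H})%N ->
    exists e : seq H, size e = k /\ orthonormal dot e.
  exists e; split => //.
  by rewrite basisEfree (orthonormal_free oe) subvf se leqnn.
elim=> [_|k IH kn]; first by exists [::].
have [e [se oe]] := IH (ltnW kn).
have /subvPn[v _ vS] : ~~ (fullv <= <<e>>)%VS.
  apply/negP => /dimvS; move: (orthonormal_free oe).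
  by rewrite /free => /eqP ->; rewrite se leqNgt kn.
have [X XS [Y [vE XY Ye]]] := orthogonal_split dot e v.
have Y0 : Y != 0.
  by apply: contra vS => /eqP Y0; rewrite vE Y0 addr0.
pose c := (sqrtC (dot Y Y))^-1.
exists (c *: Y :: e); split; first by rewrite /= se.
rewrite -cat1s orthonormal_cat oe /=; apply/andP; split.
  rewrite /orthonormal/= ?andbT dnormZ.
  rewrite normrV ?unitfE ?sqrt_dnorm_eq0// (ger0_norm (sqrt_dnorm_ge0 _ _)).
  by rewrite exprVn sqrtCK mulVf// dnorm_eq0.
apply/orthoPl => z ze.
by rewrite linearZl_LR/= (orthoPl Ye)// mulr0.
Qed.

Lemma hnorm_bounded (f : 'End(H)) : exists2 M, 0 <= M &
  forall x, hnorm (f x) <= M * hnorm x.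
Proof.
have [e [oe be]] := orthonormal_basis.
exists (\sum_(i < size e) hnorm (f e`_i)).
  by apply: sumr_ge0 => i _; exact: hnorm_ge0.
move=> x; have := coord_basis (X := in_tuple e) be (memvf x).
set c := fun i => coord (in_tuple e) i x => xE.
have cE i : c i = dot x e`_i.
  rewrite [in RHS]xE linear_sumlz (bigD1 i)//= big1 ?addr0.
    rewrite linearZl_LR/=; case/orthonormalP: oe => ue ->; rewrite ?mem_nth//.
    by rewrite eqxx mulr1.
  move=> j ji; rewrite linearZl_LR/=; case/orthonormalP: oe => ue ->;
    rewrite ?mem_nth// nth_uniq//.
  by rewrite (inj_eq val_inj) (negbTE ji) mulr0.
rewrite {1}xE linear_sum/= (le_trans (hnorm_sum _ _ _))// mulr_suml.
apply: ler_sum => i _; rewrite linearZ/= hnormZ mulrC ler_wpM2l ?hnorm_ge0//.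
rewrite -[coord _ _ _]/(c i) cE (le_trans (normc_dot_le _ _))//.
suff -> : hnorm e`_i = 1 by rewrite mulr1.
case/orthonormalP: oe => ue oe.
by rewrite /hnorm oe ?mem_nth// eqxx/= sqrtr1.
Qed.

Lemma opnorm_has_sup (f : 'End(H)) :
  has_sup [set hnorm (f x) | x in [set x | hnorm x <= 1]].
Proof.
split; first by exists (hnorm (f 0)), 0 => //=; rewrite hnorm0.
have [M M0 fM] := hnorm_bounded f.
exists M => _ [x /= x1 <-]; rewrite (le_trans (fM x))//.
by rewrite ler_piMr.
Qed.

Lemma hnorm_le_opnorm (f : 'End(H)) x : hnorm (f x) <= opnorm f * hnorm x.
Proof.
have [->|x0] := eqVneq x 0; first by rewrite linear0 hnorm0 mulr0.
have nx0 : 0 < hnorm x.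
  by rewrite lt_def hnorm_ge0 andbT; apply: contra_neq x0; exact: hnorm_eq0.
rewrite -ler_pdivrMr// mulrC.
have normV : normc (hnorm x)^-1%:C = (hnorm x)^-1.
  by rewrite /normc/= expr0n addr0 sqrtr_sqr ger0_norm// invr_ge0 ltW.
apply: ub_le_sup; first by case: (opnorm_has_sup f).
exists ((hnorm x)^-1%:C *: x) => /=; first by rewrite hnormZ normV mulVf// gt_eqF.
by rewrite linearZ/= hnormZ normV.
Qed.

Lemma opnorm_le (f : 'End(H)) M : 0 <= M ->
  (forall x, hnorm (f x) <= M * hnorm x) -> opnorm f <= M.
Proof.
move=> M0 fM; apply: ge_sup; first by case: (opnorm_has_sup f).
by move=> _ [x /= x1 <-]; rewrite (le_trans (fM x))// ler_piMr.
Qed.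

Lemma opnorm_ge0 (f : 'End(H)) : 0 <= opnorm f.
Proof.
apply: ub_le_sup; first by case: (opnorm_has_sup f).
by exists 0; rewrite /= ?linear0 hnorm0.
Qed.

End hilbert_norm.

(* The bounded operators on H with the operator norm, as a real normed space:
   scalars are restricted to R so that derivatives of curves R -> endop dot are
   those of the library. *)
Definition endop {R : realType} {H : vectType R[i]} (dot : {dot H for conjC})
  : Type := 'End(H).

Section endop_normed.
Context {R : realType} {H : vectType R[i]}.
Variable dot : {dot H for conjC}.
Local Notation E := (endop dot).

HB.instance Definition _ := GRing.Zmodule.copy E 'End(H).

Definition endop_scale (a : R) (f : E) : E := a%:C *: (f : 'End(H)).

Fact endop_scaleA a b f :
  endop_scale a (endop_scale b f) = endop_scale (a * b) f.
Proof. by rewrite /endop_scale scalerA rmorphM. Qed.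

Fact endop_scale1 : left_id 1 endop_scale.
Proof. by move=> f; rewrite /endop_scale scale1r. Qed.

Fact endop_scaleDr : right_distributive endop_scale +%R.
Proof. by move=> a f g; rewrite /endop_scale scalerDr. Qed.

Fact endop_scaleDl f : {morph endop_scale^~ f : a b / a + b}.
Proof. by move=> a b; rewrite /endop_scale rmorphD scalerDl. Qed.

HB.instance Definition _ := GRing.Zmodule_isLmodule.Build R E
  endop_scaleA endop_scale1 endop_scaleDr endop_scaleDl.

Fact endop_ler_normD (f g : E) :
  opnorm dot (f + g) <= opnorm dot f + opnorm dot g.
Proof.
apply: opnorm_le; first by rewrite addr_ge0// opnorm_ge0.
move=> x; rewrite add_lfunE mulrDl (le_trans (hnormD _ _ _))//.
by rewrite lerD// hnorm_le_opnorm.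
Qed.

Fact endop_normrZ (a : R) (f : E) : opnorm dot (a *: f) = `|a| * opnorm dot f.
Proof.
have na b : normc b%:C = `|b| :> R by rewrite /normc/= expr0n addr0 sqrtr_sqr.
have le b g : opnorm dot (b *: (g : E)) <= `|b| * opnorm dot g.
  apply: opnorm_le; first by rewrite mulr_ge0// opnorm_ge0.
  move=> x; rewrite scale_lfunE hnormZ na -mulrA ler_wpM2l//.
  exact: hnorm_le_opnorm.
apply/eqP; rewrite eq_le le/=.
have [->|a0] := eqVneq a 0; first by rewrite normr0 mul0r opnorm_ge0.
rewrite mulrC -ler_pdivlMr ?normr_gt0// mulrC -normfV.
by have := le a^-1 (a *: f); rewrite scalerA mulVf// scale1r.
Qed.

Fact endop_normr0_eq0 (f : E) : opnorm dot f = 0 -> f = 0.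
Proof.
move=> f0; apply/lfunP => x; rewrite zero_lfunE; apply: (@hnorm_eq0 _ _ dot).
apply/eqP; rewrite eq_le hnorm_ge0 andbT.
by have := hnorm_le_opnorm dot f x; rewrite f0 mul0r.
Qed.

HB.instance Definition _ := Lmodule_isNormed.Build R E
  endop_ler_normD endop_normrZ endop_normr0_eq0.

End endop_normed.

Section curves.
Context {R : realType} {V : normedModType R}.

(* Continuously differentiable on the closed interval [c, d], with one-sided
   derivatives at c and d. *)
Definition C1_on (f : R -> V) (c d : R) : Prop :=
  exists2 g : R -> V, {within `[c, d], continuous g} &
    forall t, t \in `[c, d] ->
      (s - t)^-1 *: (f s - f t) @[s --> within `[c, d] t^'] --> g t.

Definition piecewise_C1 (f : R -> V) (a b : R) : Prop :=
  exists2 s : seq R, itv_partition a b s &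
    forall i, (i < size s)%N -> C1_on f (nth b (a :: s) i) (nth b s i).

(* derive1 is unspecified at the finitely many break points and at a and b;
   these form a null set. *)
Definition curve_length (f : R -> V) (a b : R) : \bar R :=
  \int[lebesgue_measure]_(t in `[a, b]) (`|derive1 f t|%:E).

End curves.

Section endomorphisms.
Context {K : fieldType} {H : vectType K}.

Definition lfun_mx (f : 'End(H)) : 'M[K]_(\dim {:H}) :=
  passmx.mxof (vbasis {:H}) (vbasis {:H}) f.

Definition lfun_det (f : 'End(H)) : K := \det (lfun_mx f).

Definition lfun_char_poly (f : 'End(H)) : {poly K} := char_poly (lfun_mx f).

End endomorphisms.

Definition expi {R : realType} (x : R) : R[i] := cos x +i* sin x.

Section unitary.
Context {R : realType} {H : vectType R[i]}.
Variable dot : {dot H for conjC}.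

Definition unitary : set (endop dot) :=
  [set u : 'End(H) | isometry dot dot u /\ limg u = fullv].

Definition ucover : set (endop dot * R) :=
  [set p | unitary p.1 /\ lfun_det p.1 = expi p.2].

Definition unitary_path (u v : endop dot) (a b : R) (gamma : R -> endop dot)
    : Prop :=
  [/\ a < b, piecewise_C1 gamma a b,
      forall t, t \in `[a, b] -> unitary (gamma t),
      gamma a = u & gamma b = v].

Definition ucover_path (p q : endop dot * R) (a b : R)
    (gamma : R -> endop dot) (phi : R -> R) : Prop :=
  [/\ a < b, piecewise_C1 gamma a b /\ piecewise_C1 phi a b,
      forall t, t \in `[a, b] -> ucover (gamma t, phi t),
      (gamma a, phi a) = p & (gamma b, phi b) = q].

Definition unitary_dist (u v : endop dot) : \bar R :=
  ereal_inf [set l | exists a b gamma,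
    unitary_path u v a b gamma /\ l = curve_length gamma a b].

Definition ucover_dist (p q : endop dot * R) : \bar R :=
  ereal_inf [set l | exists a b gamma phi,
    ucover_path p q a b gamma phi /\ l = curve_length gamma a b].

End unitary.
Arguments unitary {R H} dot _.
Arguments ucover {R H} dot _.
Arguments unitary_path {R H} dot u v a b gamma.
Arguments ucover_path {R H} dot p q a b gamma phi.
Arguments unitary_dist {R H} dot u v.
Arguments ucover_dist {R H} dot p q.

Section angles.
Context {R : realType} {N : nat}.

Definition angle_lifts (lam : 'I_N -> R[i]) (s : R) : set ('I_N -> R) :=
  [set theta | (forall i, expi (theta i) = lam i) /\ \sum_(i < N) theta i = s].

Definition max_abs (theta : 'I_N -> R) : R :=
  \big[Num.max/0]_(i < N) `|theta i|.

End angles.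

Definition is_minimum {R : realType} (A : set R) (m : R) : Prop :=
  A m /\ forall x, A x -> m <= x.

(* Main.v *)
Require Import Defs.
From HB Require Import structures.
From mathcomp Require Import all_boot all_order all_algebra.
From mathcomp Require Import all_classical all_reals all_analysis.
From mathcomp Require Import complex.
From mathcomp Require Import perm measurable_realfun lra ring zify.

Set Implicit Arguments.
Unset Strict Implicit.
Unset Printing Implicit Defensive.

Import Order.TTheory GRing.Theory Num.Theory Num.Def.
Import numFieldNormedType.Exports.
Local Open Scope classical_set_scope.
Local Open Scope ring_scope.
Local Open Scope complex_scope.
Import ComplexField.Normc.

(** Both parts of the theorem come from comparing [m] with lengths of paths,
    once from above and once from below.

    Upper bound. The unitary [w = v u^-1] is diagonal, with entries
    [expi (theta i)], in an orthonormal frame ([unitary_frame_diag]), for every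
    choice [theta] of arguments of its eigenvalues. If the arguments add up to
    [psi - phi], the path that replaces [theta] by [t * theta], followed by
    [u], lifts to a path in the cover from [(u, phi)] to [(v, psi)]. Its
    velocity has the constant norm [max_abs theta], so the distance in the
    cover is at most [m] ([rotation_dist_le]). Choosing all arguments within
    [2 * pi] of their mean ([lifts_near_mean]) gives the upper bound of part 2.

    Lower bounds. Let [D s t] be a pseudo-distance between the times of a path
    [gamma] that is, near each time [p], bounded by the chord
    [r = |gamma t - gamma p|] up to a factor [1 - r^2 / 4] which tends to 1.
    Adding up small steps shows that [D a b] is at most the length of [gamma]
    ([length_lower_bound]). The same principle serves twice.
    - With [D s t = |phi t - phi s| / N]: the determinant of
      [gamma t gamma(s)^-1] is the product of its [N] eigenvalues, all within
      [r] of 1, so that the angle [phi] changes by at most [N] times an arc of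
      chord [r]. This is the lower bound of part 2
      ([cover_angle_le_length]).
    - With [D s t] the angle between [gamma s y] and [gamma t y] on the unit
      sphere, for [y] the preimage under [u] of an eigenvector of [w]: the
      length is at least the absolute value of the principal argument of the
      eigenvalue ([eigenvalue_arg_le_length]), whence a lower bound for the
      distance in the unitary group itself.

    Part 1. If the distance in the cover is at most [pi / (2 * N)], the
    principal arguments are bounded by [pi / (2 * N)], so that their sum and
    [psi - phi] both lie in [[- pi / 2, pi / 2]]. They are congruent modulo
    [2 * pi], hence equal: the principal arguments are an admissible choice,
    and [m <= max |arg| <= d <= d~ <= m]. *)

(** * The modulus of a complex number *)

Section complex_modulus.
Context {R : realType}.
Implicit Types (z : R[i]) (a : R).

Lemma normc_ge0 z : 0 <= normc z.
Proof. by case: z => *; exact: sqrtr_ge0. Qed.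

Lemma normc_real a : normc a%:C = `|a|.
Proof. by rewrite /normc/= expr0n addr0 sqrtr_sqr. Qed.

Lemma normc_Re z : `|complex.Re z| <= normc z.
Proof.
case: z => p q /=; rewrite -sqrtr_sqr ler_sqrt ?lerDl ?sqr_ge0//.
by rewrite addr_ge0 ?sqr_ge0.
Qed.

Lemma normc_le_ReIm z : normc z <= `|complex.Re z| + `|complex.Im z|.
Proof.
case: z => p q /=.
rewrite -(@ler_pXn2r _ 2)// ?nnegrE ?sqrtr_ge0 ?addr_ge0//.
rewrite sqr_sqrtr ?addr_ge0 ?sqr_ge0// sqrrD !real_normK ?num_real//.
by rewrite lerD2r lerDl mulrn_wge0// mulr_ge0.
Qed.

Lemma Re_mul_conj z : complex.Re (z * conjC z) = normc z ^+ 2.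
Proof.
by case: z => p q; rewrite /normc sqr_sqrtr ?addr_ge0 ?sqr_ge0//=; ring.
Qed.

Lemma mul_conj_unit z : normc z = 1 -> z * conjC z = 1.
Proof.
move=> z1; apply/eqP; rewrite eq_complex Re_mul_conj z1 expr1n/= eqxx/=.
by case: z z1 => p q _ /=; apply/eqP; ring.
Qed.

End complex_modulus.

(** * Arcs and chords of the unit circle *)

Section circle.
Context {R : realType}.
Implicit Types x y s t a theta : R.

Lemma expi0 : expi 0 = 1 :> R[i].
Proof. by rewrite /expi cos0 sin0. Qed.

Lemma expiD x y : expi (x + y) = expi x * expi y.
Proof.
by apply/eqP; rewrite eq_complex /expi/= cosD sinD eqxx/= addrC [X in X + _]mulrC.
Qed.

Lemma expi_sum (I : Type) (r : seq I) (P : pred I) (F : I -> R) :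
  expi (\sum_(i <- r | P i) F i) = \prod_(i <- r | P i) expi (F i).
Proof. exact: (big_morph _ expiD expi0). Qed.

Lemma normc_expi x : normc (expi x) = 1.
Proof. by rewrite /normc/= cos2Dsin2 sqrtr1. Qed.

Lemma expi_neq0 x : expi x != 0.
Proof.
apply/eqP => x0; have := normc_expi x; rewrite x0 normc0.
by move/eqP; rewrite eq_sym oner_eq0.
Qed.

Lemma expi2pi : expi (2 * pi) = 1 :> R[i].
Proof. by rewrite /expi mulr_natl cos2pi sin2pi. Qed.

Lemma expi_2piz (k : int) : expi (2 * pi * k%:~R) = 1 :> R[i].
Proof.
have natk (n : nat) : expi (2 * pi * n%:R) = 1 :> R[i].
  elim: n => [|n IH]; first by rewrite mulr0 expi0.
  by rewrite -(natr1 n) mulrDr expiD IH mulr1 expi2pi mul1r.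
case: k => n; first by rewrite -pmulrn natk.
rewrite NegzE mulrNz mulrN -pmulrn.
have := expiD (2 * pi * n.+1%:R) (- (2 * pi * n.+1%:R)).
by rewrite subrr expi0 natk mul1r => <-.
Qed.

(** A difference [d] of the arguments has [cos d = 1], so [sin (d / 2) = 0] by
    the duplication formula, while [sin] is positive on [(0, pi)]. *)
Lemma expi_inj_small x y : `|x - y| < 2 * pi -> expi x = expi y -> x = y.
Proof.
move=> + xy.
have : expi (x - y) = 1.
  apply: (mulIf (expi_neq0 y)).
  by rewrite -expiD subrK mul1r.
move=> e1 dpi; apply/eqP; rewrite -subr_eq0; move: e1 dpi.
move: (x - y) => d [cd _] dpi.
apply/negPn/negP => d0.
have : 0 < sin (`|d| / 2).
  apply: sin_gt0_pi; rewrite divr_gt0 ?normr_gt0//=.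
  by rewrite ltr_pdivrMr// mulrC.
suff -> : sin (`|d| / 2) = 0 by rewrite ltxx.
have : cos `|d| = 1 by case: (ger0P d) => _ //; rewrite cosN.
have {1}-> : `|d| = (`|d| / 2) *+ 2 by rewrite -mulr_natr divfK.
rewrite cos_mulr2n => h.
have := cos2Dsin2 (`|d| / 2).
by move=> h2; apply/eqP; rewrite -sqrf_eq0; apply/eqP; move: h; rewrite mulr2n; lra.
Qed.

Lemma expi_surj (z : R[i]) : normc z = 1 -> exists2 t : R, `|t| <= pi & expi t = z.
Proof.
case: z => a b; rewrite /normc => n1.
have ab1 : a ^+ 2 + b ^+ 2 = 1.
  by rewrite -[LHS]sqr_sqrtr ?n1 ?expr1n// addr_ge0// sqr_ge0.
have a1 : -1 <= a <= 1.
  rewrite -ler_norml -(@ler_pXn2r _ 2)// ?nnegrE// expr1n -normrX ger0_norm ?sqr_ge0//.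
  by rewrite -ab1 lerDl sqr_ge0.
have [/andP[t0 tpi] ct] := acos_def a1.
have st := sin_acos a1.
have bE : Num.sqrt (1 - a ^+ 2) = `|b|.
  by rewrite -ab1 addrAC subrr add0r sqrtr_sqr.
have [b0|b0] := leP 0 b.
  by exists (acos a); rewrite ?ger0_norm// /expi ct st bE ger0_norm.
exists (- acos a); first by rewrite normrN ger0_norm.
by rewrite /expi cosN sinN ct st bE ltr0_norm// opprK.
Qed.

Lemma expi_inj_2pi x y : expi x = expi y -> exists k : int, x = y + 2 * pi * k%:~R.
Proof.
move=> xy; pose k := Num.floor ((x - y) / (2 * pi)); exists k.
have p2 : 0 < 2 * pi :> R by rewrite mulr_gt0// pi_gt0.
apply: expi_inj_small; last by rewrite expiD expi_2piz mulr1.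
have /andP[k1 k2] := floor_itv ((x - y) / (2 * pi)).
rewrite -/k ler_pdivlMr// ltr_pdivrMr// intrD mulrDl mul1r in k1 k2.
by rewrite opprD addrA ger0_norm; rewrite [2 * pi * _]mulrC; lra.
Qed.

Lemma expi_surj_window (c : R) (z : R[i]) : normc z = 1 ->
  exists t : R, [/\ expi t = z, c - 2 * pi < t & t <= c].
Proof.
move=> /expi_surj[t _ tz]; have p2 : 0 < 2 * pi :> R by rewrite mulr_gt0// pi_gt0.
pose k := Num.floor ((c - t) / (2 * pi)).
have /andP[k1 k2] := floor_itv ((c - t) / (2 * pi)).
rewrite -/k ler_pdivlMr// ltr_pdivrMr// intrD mulrDl mul1r in k1 k2.
exists (t + 2 * pi * k%:~R).
split; [by rewrite expiD expi_2piz mulr1|rewrite [2 * pi * _]mulrC; lra|].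
by rewrite [2 * pi * _]mulrC; lra.
Qed.

(** The duplication formulas of [cos] and [sin] at [t / 2]. *)
Lemma chord_expi t : normc (expi t - 1) = 2 * `|sin (t / 2)|.
Proof.
rewrite /normc/= subr0.
have {1 2}-> : t = (t / 2) *+ 2 by rewrite -mulr_natr divfK.
rewrite cos_mulr2n sin_mulr2n.
have := cos2Dsin2 (t / 2); move: (cos _) (sin _) => c s cs.
have -> : (c ^+ 2 *+ 2 - 1 - 1) ^+ 2 + (c * s *+ 2) ^+ 2 = (2 * s) ^+ 2.
  have -> : c ^+ 2 *+ 2 - 1 - 1 = - (2 * s ^+ 2) by rewrite mulr2n; lra.
  have -> : (- (2 * s ^+ 2)) ^+ 2 + (c * s *+ 2) ^+ 2 =
     4 * s ^+ 2 * (c ^+ 2 + s ^+ 2) by ring.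
  by rewrite cs; ring.
by rewrite sqrtr_sqr normrM gtr0_norm.
Qed.

(** By the mean value theorem [sin x = x * cos c] with [c <= x], and [cos] decreases. *)
Lemma mul_cos_le_sin x : 0 <= x <= pi / 2 -> x * cos x <= sin x.
Proof.
move=> /andP[x0 xpi].
have [c] := @MVT_segment R sin cos 0 x x0 (fun z _ => is_derive_sin z)
  (continuous_subspaceT (@continuous_sin R)).
rewrite in_itv/= sin0 !subr0 => /andP[c0 cx] ->; rewrite mulrC ler_wpM2r//.
have pi2 : pi / 2 <= pi :> R by have := pi_gt0 R; lra.
by rewrite leNgt ltr_cos ?in_itv/= -?leNgt ?x0 ?c0//=; lra.
Qed.

(** Arcs are not much longer than their chords, with an explicit factor: for
    [x = |t| / 2] the chord [r] is [2 * sin x], so [1 - r^2 / 4 = cos x ^ 2], and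
    the claim follows from [x * cos x <= sin x]. The factor is polynomial in the
    chord, which spares limits of trigonometric functions in the length
    estimates. *)
Lemma arc_le_chord t : `|t| <= pi ->
  `|t| * (1 - normc (expi t - 1) ^+ 2 / 4) <= normc (expi t - 1).
Proof.
move=> tpi; rewrite chord_expi.
have -> : `|sin (t / 2)| = sin (`|t| / 2).
  have [t0|t0] := ger0P t.
    by rewrite ger0_norm// sin_ge0_pi//; move: tpi; rewrite ger0_norm//; have := pi_gt0 R; lra.
  rewrite mulNr sinN -normrN ger0_norm// -sinN sin_ge0_pi//.
  by move: tpi; rewrite ltr0_norm//; have := pi_gt0 R; lra.
have t0 := normr_ge0 t; move: tpi t0; move: `|t| => {}t tpi t0.
have h : t / 2 * cos (t / 2) <= sin (t / 2) by apply: mul_cos_le_sin; lra.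
have c0 : 0 <= cos (t / 2) by apply: cos_ge0_pihalf; have := pi_gt0 R; lra.
have := cos2Dsin2 (t / 2); have := cos_le1 (t / 2).
move: (cos _) (sin _) c0 h => c s c0 h c1 cs.
have s4 : (2 * s) ^+ 2 / 4 = s ^+ 2 by field.
have -> : 1 - (2 * s) ^+ 2 / 4 = c ^+ 2 by rewrite s4; lra.
have tc : 0 <= t * c * (1 - c) by rewrite mulr_ge0 ?subr_ge0// mulr_ge0.
have -> : t * c ^+ 2 = t * c - t * c * (1 - c) by ring.
by lra.
Qed.

Lemma norm_sin_le x : `|sin x| <= `|x|.
Proof.
wlog x0 : x / 0 <= x.
  move=> h; case: (leP 0 x) => [|/ltW x0]; first exact: h.
  by rewrite -normrN -sinN -[leRHS]normrN h// oppr_ge0.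
have [c _] := @MVT_segment R sin cos 0 x x0 (fun z _ => is_derive_sin z)
  (continuous_subspaceT (@continuous_sin R)).
by rewrite sin0 !subr0 => ->; rewrite normrM ler_piMl// cos_max.
Qed.

Lemma chord_le_arc x : normc (expi x - 1) <= `|x|.
Proof.
rewrite chord_expi mulrC -ler_pdivlMr// (le_trans (norm_sin_le _))//.
by rewrite normrM [`|2^-1|]ger0_norm.
Qed.

(** The quadratic bound makes the derivative of the path of rotations explicit.
    Real and imaginary parts contribute [a ^ 2] each, by the mean value theorem. *)
Lemma expi_taylor1 a : normc (expi a - 1 - 'i * a%:C) <= 2 * a ^+ 2.
Proof.
wlog a0 : a / 0 <= a.
  move=> h; case: (leP 0 a) => [|/ltW a0]; first exact: h.
  have := h (- a); rewrite oppr_ge0 sqrrN => /(_ a0); congr (_ <= _).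
  rewrite /expi cosN sinN /normc/=; congr Num.sqrt.
  by ring.
apply: (le_trans (normc_le_ReIm _)).
have -> : complex.Re (expi a - 1 - 'i * a%:C) = cos a - 1 by rewrite /expi/=; ring.
have -> : complex.Im (expi a - 1 - 'i * a%:C) = sin a - a by rewrite /expi/=; ring.
rewrite mulr_natl mulr2n; apply: lerD.
  have [c] := @MVT_segment R cos (fun x => - sin x) 0 a a0
    (fun z _ => is_derive_cos z) (continuous_subspaceT (@continuous_cos R)).
  rewrite in_itv/= cos0 subr0 => /andP[c0 ca] ->.
  rewrite normrM normrN (ger0_norm a0) ler_wpM2r//.
  by rewrite (le_trans (norm_sin_le c))// ger0_norm.
have csub : continuous (fun x : R => sin x - x).
  by move=> z; apply: cvgB; [exact: continuous_sin|exact: cvg_id].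
have [c] := @MVT_segment R (fun x => sin x - x) (fun x => cos x - 1) 0 a a0
    (fun z _ => is_deriveB (is_derive_sin z) (is_derive_id z 1))
    (continuous_subspaceT csub).
rewrite in_itv/= sin0 subrr !subr0 => /andP[c0 ca] ->.
rewrite normrM (ger0_norm a0) ler_wpM2r//.
have := le_trans (normc_Re (expi c - 1)) (chord_le_arc c).
by rewrite (ger0_norm c0) => /le_trans; apply.
Qed.

Lemma expi_lipschitz x y : normc (expi x - expi y) <= `|x - y|.
Proof.
rewrite -[x in expi x](subrK y) expiD -[X in _ - X]mul1r -mulrBl normcM normc_expi mulr1.
exact: chord_le_arc.
Qed.

End circle.

(** * Arguments with a prescribed sum *)

Section angle_lifts.
Context {R : realType} {N : nat}.
Implicit Types (theta : 'I_N -> R) (lam : 'I_N -> R[i]) (s : R).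

Lemma max_abs_le theta (c : R) : 0 <= c ->
  (forall i, `|theta i| <= c) -> max_abs theta <= c.
Proof. by move=> c0 h; apply: bigmax_le => // i _; exact: h. Qed.

Lemma max_abs_ge0 theta : 0 <= max_abs theta.
Proof. exact: bigmax_ge_id. Qed.

Lemma le_max_abs theta i : `|theta i| <= max_abs theta.
Proof. exact: le_bigmax. Qed.

(** Choosing each argument in the window of length [2 * pi] that ends at the mean
    [s / N] makes the sum too small by [2 * pi * k] with [0 <= k < N]; adding
    [2 * pi] to the first [k] arguments repairs it, and they remain within
    [2 * pi] of the mean. *)
Lemma lifts_near_mean lam s : (0 < N)%N -> (forall i, normc (lam i) = 1) ->
  \prod_(i < N) lam i = expi s ->
  exists2 theta, angle_lifts lam s theta & forall i, `|theta i - s / N%:R| <= 2 * pi.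
Proof.
move=> N0 lam1 lams; have N0R : 0 < N%:R :> R by rewrite ltr0n.
have p2 : 0 < 2 * pi :> R by rewrite mulr_gt0// pi_gt0.
have /choice[f fP] : forall i, exists t : R,
    [/\ expi t = lam i, s / N%:R - 2 * pi < t & t <= s / N%:R].
  by move=> i; exact: expi_surj_window.
have : expi s = expi (\sum_i f i).
  by rewrite expi_sum -lams; apply: eq_bigr => i _; have [] := fP i.
move/expi_inj_2pi => [k sk].
have sN : \sum_(i < N) (s / N%:R) = s.
  by rewrite sumr_const card_ord -[LHS]mulr_natr divfK// gt_eqF.
have k0 : 0 <= 2 * pi * k%:~R :> R.
  suff : \sum_i f i <= s by rewrite sk; lra.
  by rewrite -[leRHS]sN; apply: ler_sum => i _; have [] := fP i.
have kN : 2 * pi * k%:~R < 2 * pi * N%:R :> R.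
  suff : s - 2 * pi * N%:R < \sum_i f i by move: sk; lra.
  rewrite -[X in X - _]sN; have -> : 2 * pi * N%:R = \sum_(i < N) (2 * pi) :> R.
    by rewrite sumr_const card_ord mulr_natr.
  rewrite -sumrB; apply: ltr_sum => [|i _]; last by have [] := fP i.
  by apply/hasP; exists (Ordinal N0) => //; exact: mem_index_enum.
rewrite pmulr_rge0// ler0z in k0.
case: k k0 => // n _ in sk kN *; rewrite ltr_pM2l// -pmulrn ltr_nat in kN.
(* [n] is the number of missing turns, given to the first [n] arguments *)
exists (fun i => f i + 2 * pi * (i < n)%:R).
  split=> [i|].
    have [<- _ _] := fP i; case: ltnP => _; last by rewrite mulr0 addr0.
    by rewrite mulr1 expiD expi2pi mulr1.
  rewrite big_split/= sk; congr (_ + _); rewrite -mulr_sumr; congr (_ * _).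
  rewrite -natr_sum -pmulrn; congr (_%:R).
  by rewrite -big_mkcond/= -(big_ord_widen N (fun=> 1%N) (ltnW kN)) sum1_card card_ord.
move=> i; have [_ f1 f2] := fP i.
by rewrite ler_norml; case: ltnP => _ /=; lra.
Qed.

(** Lifts that do no worse than a given one differ from it by multiples of
    [2 * pi] that are bounded, so the minimum is taken over a finite set. The
    shifts are encoded as [k i - K] with [k i <= 2 * K], where [K] exceeds the
    largest shift that can be of use. *)
Lemma min_max_abs lam s : angle_lifts lam s !=set0 ->
  exists m : R, is_minimum [set max_abs theta | theta in angle_lifts lam s] m.
Proof.
move=> [th0 [th0l th0s]]; have p2 : 0 < 2 * pi :> R by rewrite mulr_gt0// pi_gt0.
pose M := max_abs th0; pose K := (Num.trunc (M / pi)).+1.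
have MK : M < pi * K%:R.
  by rewrite mulrC -ltr_pdivrMr ?pi_gt0//; exact: truncnS_gt.
pose th (k : {ffun 'I_N -> 'I_(K.*2.+1)}) i := th0 i + 2 * pi * ((k i)%:R - K%:R).
have thl k i : expi (th k i) = lam i.
  rewrite expiD th0l; have -> : (k i)%:R - K%:R = (Posz (k i) - Posz K)%:~R :> R.
    by rewrite intrB.
  by rewrite expi_2piz mulr1.
have Kb : (K < K.*2.+1)%N by rewrite ltnS -addnn leq_addr.
pose k0 : {ffun 'I_N -> 'I_(K.*2.+1)} := [ffun=> Ordinal Kb].
have thk0 : th k0 = th0.
  by apply/funext => i; rewrite /th ffunE/= subrr mulr0 addr0.
pose P (k : {ffun 'I_N -> 'I_(K.*2.+1)}) := `[< \sum_i th k i = s >].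
have Pk0 : P k0 by apply/asboolP; rewrite thk0.
have [k Pk kmin] := arg_minP (fun k => max_abs (th k)) Pk0.
exists (max_abs (th k)); split.
  by exists (th k) => //; split; [exact: thl|exact/asboolP].
move=> _ [t [tl ts] <-].
have [tM|Mt] := leP (max_abs t) M; last first.
  by rewrite (le_trans (kmin k0 Pk0))// thk0 ltW.
have /choice[n nE] : forall i, exists n : int, t i = th0 i + 2 * pi * n%:~R.
  by move=> i; apply: expi_inj_2pi; rewrite tl th0l.
have nK i : - (K%:Z) <= n i <= K%:Z.
  rewrite -!(ler_int R) intrN -pmulrn -ler_norml.
  rewrite -(@ler_pM2l _ (2 * pi))//.
  have -> : 2 * pi * `|(n i)%:~R| = `|t i - th0 i|.
    by rewrite nE addrC addKr normrM (gtr0_norm p2).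
  rewrite (le_trans (ler_normB _ _))//.
  have := le_max_abs t i; have := le_max_abs th0 i; rewrite -/M; lra.
have nn i : (`|(n i + K%:Z)%R|%N < K.*2.+1)%N.
  by have := nK i; rewrite ltnS -addnn; lia.
pose k1 : {ffun 'I_N -> 'I_(K.*2.+1)} := [ffun i => Ordinal (nn i)].
have k1E : th k1 = t.
  apply/funext => i; rewrite /th ffunE nE/=; congr (_ + _ * _).
  have -> : `|(n i + K%:Z)%R|%N%:R = (n i + K%:Z)%:~R :> R.
    by rewrite pmulrn; congr (_%:~R); have := nK i; lia.
  by rewrite intrD -pmulrn addrK.
by rewrite -k1E; apply: kmin; apply/asboolP; rewrite k1E.
Qed.

End angle_lifts.

(** * The speed of a C1 curve *)

Section increments.
Context {R : realType} {V : normedModType R}.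
Implicit Types (f g : R -> V) (c d : R).

Lemma C1_on_increment f g c d t (e : R) :
  (s - t)^-1 *: (f s - f t) @[s --> within `[c, d] t^'] --> g t ->
  0 < e ->
  exists2 delta : R, 0 < delta & forall s, s \in `[c, d] -> `|s - t| < delta ->
    `|f s - f t| <= (`|g t| + e) * `|s - t|.
Proof.
move=> /cvgrPdist_lt/(_ e) + e0 => /(_ e0).
rewrite near_withinE => /nbhs_ballP[delta /= delta0 h]; exists delta => // s scd sd.
have [->|st] := eqVneq s t; first by rewrite !subrr !normr0 mulr0.
have := h s; rewrite /ball/= distrC => /(_ sd st scd) hs.
have st0 : 0 < `|s - t| by rewrite normr_gt0 subr_eq0.
rewrite -ler_pdivrMr// mulrC -normfV -normrZ.
set q := _ *: _ in hs *.
have -> : q = g t - (g t - q) by rewrite opprB addrC subrK.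
by rewrite (le_trans (ler_normB _ _))// lerD2l ltW.
Qed.

Lemma C1_on_derive1 f g c d t :
  (s - t)^-1 *: (f s - f t) @[s --> within `[c, d] t^'] --> g t ->
  t \in `]c, d[ -> derive1 f t = g t.
Proof.
move=> fg tcd; apply: cvg_lim => //.
apply/cvgrPdist_lt => e e0.
move: fg => /cvgrPdist_lt/(_ e e0).
rewrite near_withinE => /nbhs_ballP[delta /= delta0 h].
have : \forall h \near (0 : R), h + t \in `]c, d[.
  have ht : h + t @[h --> (0:R)] --> t.
    by rewrite -{2}[t]add0r; apply: cvgD; [exact: cvg_id|exact: cvg_cst].
  exact: (ht [set z | z \in `]c, d[] (near_in_itvoo tcd)).
move=> /nbhs_ballP[eta /= eta0 hc].
apply/nbhs_ballP; exists (Num.min delta eta); first by rewrite /= lt_min delta0 eta0.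
move=> z; rewrite /ball/= sub0r normrN lt_min => /andP[zd ze] z0.
have := h (z + t); rewrite /ball/= addrK opprD addrCA subrr addr0 normrN; apply => //.
  by apply: contra_neq z0 => /(congr1 (fun x => x - t)); rewrite addrK subrr.
have := hc z; rewrite /ball/= sub0r normrN => /(_ ze).
by rewrite !in_itv/= => /andP[/ltW-> /ltW->].
Qed.

End increments.

Section sup_argument.
Context {R : realType}.
Variables (c d : R) (G : R -> R) (D : R -> R -> R).
Hypothesis cd : c <= d.
Hypothesis triangle : forall r s t, r \in `[c, d] -> s \in `[c, d] -> t \in `[c, d] ->
  D r t <= D r s + D s t.
Hypothesis D0 : D c c <= 0.
Hypothesis local : forall p, p \in `[c, d] -> exists2 delta : R, 0 < delta &
  forall s, s \in `[c, d] -> `|s - p| < delta ->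
    (s <= p -> D s p <= G p - G s) /\ (p <= s -> D p s <= G s - G p).

(** Continuous induction: the supremum of the times [x] with [D c x] bounded by
    the increment of [G] belongs to this set by the local bound on its left, and
    is [d] by the local bound on its right. *)
Lemma increment_le_of_local : D c d <= G d - G c.
Proof.
pose A := [set x | x \in `[c, d] /\ D c x <= G x - G c].
have cin : c \in `[c, d] by rewrite in_itv/= lexx.
have din : d \in `[c, d] by rewrite in_itv/= lexx andbT.
have Ac : A c by split => //; rewrite subrr.
have supA : has_sup A.
  by split; [exists c|exists d => x [+ _]; rewrite in_itv/= => /andP[]].
pose p := sup A.
have pin : p \in `[c, d].
  rewrite in_itv/=; apply/andP; split; first by apply: ub_le_sup => //; case: supA.
  by apply: ge_sup; [exists c|move=> x [+ _]; rewrite in_itv/= => /andP[]].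
have [delta delta0 loc] := local pin.
have Ap : A p.
  split => //; have [x [xin Ax] px] := sup_adherent delta0 supA.
  have xp : x <= p by apply: ub_le_sup => //; case: supA.
  have xd : `|x - p| < delta.
    by rewrite distrC ger0_norm ?subr_ge0//; move: px; rewrite -/p; lra.
  have [/(_ xp) h _] := loc x xin xd.
  have := triangle cin xin pin; lra.
have [dp|pd] := leP d p.
  have -> : d = p by apply/eqP; rewrite eq_le dp; move: pin; rewrite in_itv/= => /andP[].
  by case: Ap.
(* if [p < d], the set would contain a point to the right of its supremum *)
exfalso; pose x := Num.min d (p + delta / 2).
have px : p < x by rewrite lt_min pd ltrDl divr_gt0.
have xin : x \in `[c, d].
  rewrite in_itv/= ge_min lexx andbT; apply/ltW/(le_lt_trans _ px).
  by move: pin; rewrite in_itv/= => /andP[].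
have xd : `|x - p| < delta.
  rewrite gtr0_norm ?subr_gt0// ltrBlDl.
  by rewrite (@le_lt_trans _ _ (p + delta / 2)) ?ge_min ?lexx ?orbT//; lra.
have [_ /(_ (ltW px)) h] := loc x xin xd; have [_ h2] := Ap.
have : A x by split => //; have := triangle cin pin xin; lra.
by move=> /(ub_le_sup (proj2 supA)); rewrite leNgt px.
Qed.

End sup_argument.

Section piece.
Context {R : realType}.

Lemma derivable_increment (F : R -> R) (p e : R) : derivable F p 1 -> 0 < e ->
  exists2 delta : R, 0 < delta & forall s, `|s - p| < delta ->
    `|F s - F p - derive1 F p * (s - p)| <= e * `|s - p|.
Proof.
move=> dF e0.
have : (z^-1 *: ((F \o shift p) (z *: (1:R)) - F p)) @[z --> 0^'] --> derive1 F p.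
  by rewrite derive1E; exact: dF.
move=> /cvgrPdist_lt/(_ e e0)/nbhs_ballP[delta /= delta0 h].
exists delta => // s sd; have [->|sp] := eqVneq s p.
  by rewrite !subrr mulr0 subrr normr0 mulr0.
have sp0 : s - p != 0 by rewrite subr_eq0.
have := h (s - p); rewrite /ball/= sub0r normrN => /(_ sd sp0).
rewrite [_ *: 1]mulr1 subrK => hs.
rewrite -ler_pdivrMr ?normr_gt0// -normf_div mulrBl mulfK// distrC.
by rewrite (mulrC _ (s - p)^-1) ltW.
Qed.

(** The clamping of a real number to [[c, d]] is 1-Lipschitz. *)
Lemma continuous_clamp (g : R -> R) (c d : R) : c <= d ->
  {within `[c, d], continuous g} ->
  continuous (fun t => g (Num.max c (Num.min d t))).
Proof.
move=> cd /subspace_continuousP cg x.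
pose k t := Num.max c (Num.min d t).
have kin t : k t \in `[c, d] by rewrite in_itv/= /k le_max lexx/= ge_max cd ge_min lexx.
have kl s t : `|k s - k t| <= `|s - t|.
  rewrite /k /Num.max /Num.min.
  case: (ltP d s); case: (ltP d t); case: (ltP c d); case: (ltP c s); case: (ltP c t);
    move=> ? ? ? ? ?; rewrite ler_norml; case: (ger0P (s - t)); lra.
have := cg (k x) (kin x).
move=> /cvgrPdist_lt h; apply/cvgrPdist_lt => e /h.
rewrite near_withinE => /nbhs_ballP[delta /= delta0 hd].
apply/nbhs_ballP; exists delta => // y; rewrite /ball/= => xy.
apply: hd => //; last exact: kin.
by rewrite /ball/= (le_lt_trans (kl _ _)).
Qed.

(** The integral starts at [c - 1] so that [c] is an interior point and the
    primitive is differentiable on all of [[c, d]]. *)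
Lemma continuous_primitive (h : R -> R) (c d : R) : c < d -> continuous h ->
  exists F : R -> R, (forall x, x \in `[c, d] -> derivable F x 1 /\ derive1 F x = h x) /\
   (\int[lebesgue_measure]_(x in `[c, d]) (h x)%:E = (F d - F c)%:E)%E.
Proof.
move=> cd ch; pose F x := (\int[lebesgue_measure]_(t in `[(c - 1)%R, x]) h t)%R.
have dF : forall x, x \in `[c, d] -> derivable F x 1 /\ derive1 F x = h x.
  move=> x; rewrite in_itv/= => /andP[cx xd].
  have xd1 : x < d + 1 by lra.
  have c1x : c - 1 < x by lra.
  apply: (continuous_FTC1_closed xd1 _ c1x (ch x)).
  apply: continuous_compact_integrable; first exact: segment_compact.
  exact: continuous_subspaceT.
exists F; split => //; rewrite EFinB; apply: continuous_FTC2 => //.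
- exact: continuous_subspaceT.
- have cF x : x \in `[c, d] -> {for x, continuous F}.
    by move=> /dF[dFx _]; apply/differentiable_continuous/derivable1_diffP.
  split.
  + by move=> x xcd; apply: (dF x _).1; exact: subset_itv_oo_cc.
  + by apply: cvg_at_right_filter; apply: cF; rewrite in_itv/= lexx ltW.
  + by apply: cvg_at_left_filter; apply: cF; rewrite in_itv/= lexx ltW.
- by move=> x xcd; apply: (dF x _).2; exact: subset_itv_oo_cc.
Qed.

Context {V : normedModType R}.
Implicit Types (f : R -> V).

Lemma C1_on_continuous f c d : C1_on f c d -> {within `[c, d], continuous f}.
Proof.
move=> [g _ dg]; apply/subspace_continuousP => x xcd; apply/cvgrPdist_lt => e e0.
have [delta delta0 h] := C1_on_increment (dg x xcd) ltr01.
rewrite near_withinE; apply/nbhs_ballP.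
have g0 : 0 < `|g x| + 1 by rewrite ltr_pwDr.
exists (Num.min delta (e / (`|g x| + 1))) => /=; first by rewrite lt_min delta0 divr_gt0.
move=> y; rewrite /ball/= distrC lt_min => /andP[y1 y2] ycd.
by rewrite distrC (le_lt_trans (h _ ycd y1))// mulrC -ltr_pdivlMr.
Qed.

(** The derivative of [f] at the endpoints is one-sided, and [derive1] carries no
    information there. The function [h] is the speed, continued to the whole
    line by constants, so that the fundamental theorem of calculus applies at
    every point of [[c, d]]. *)
Lemma speed_extension f c d : c <= d -> C1_on f c d ->
  exists g h, [/\ forall t, t \in `[c, d] ->
      (s - t)^-1 *: (f s - f t) @[s --> within `[c, d] t^'] --> g t,
    continuous h, forall t, t \in `[c, d] -> h t = `|g t| &
    forall t, t \in `]c, d[ -> `|derive1 f t| = h t].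
Proof.
move=> cd [g cg dg]; pose h t := `|g (Num.max c (Num.min d t))|.
have hE t : t \in `[c, d] -> h t = `|g t|.
  by rewrite in_itv/= => /andP[ct td]; rewrite /h min_r// max_r.
exists g, h; split=> //.
  apply: (@continuous_clamp (fun t => `|g t|)) => //.
  by move=> t; apply: cvg_norm; exact: cg.
move=> t tcd; rewrite hE; last exact: subset_itv_oo_cc.
by rewrite (C1_on_derive1 (dg t _) tcd)//; exact: subset_itv_oo_cc.
Qed.

Lemma measurable_speed f c d : c < d -> C1_on f c d ->
  measurable_fun `[c, d] (fun t => `|derive1 f t|).
Proof.
move=> cd /(speed_extension (ltW cd))[g [h [_ ch _ d1E]]].
apply: (@measurable_fun_itv_cc _ _ _ false true).
apply: (eq_measurable_fun h); first by move=> t /set_mem/= /d1E ->.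
by apply: measurable_funTS; exact: continuous_measurable_fun.
Qed.

(** The factor [1 - r^2 / 4] costs at most a factor [1 + k] when [r <= k <= 1],
    and [k] is taken so small that this is absorbed by [2 * e * l]. *)
Lemma chord_bound_rescale (D r a l k e : R) :
  0 <= a -> 0 <= r -> 0 <= l -> 0 < e -> 0 < k -> k <= 1 ->
  D * (1 - r ^+ 2 / 4) <= r -> r <= (a + e) * l -> r <= k ->
  k * (a + 4 * e) <= e -> D <= (a + 3 * e) * l.
Proof.
move=> a0 r0 l0 e0 k0 k1 Dr ral rk ke.
have [D0|D0] := leP D 0.
  by rewrite (le_trans D0)// mulr_ge0//; lra.
have Dk : D * (1 - k / 4) <= r.
  apply: le_trans Dr; rewrite ler_pM2l//.
  have : r ^+ 2 <= k by rewrite expr2; nra.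
  lra.
have D1 : D <= r * (1 + k).
  have : D * (1 - k / 4) * (1 + k) <= r * (1 + k) by rewrite ler_wpM2r//; lra.
  apply: le_trans; rewrite -mulrA ler_peMr ?ltW//; nra.
apply: (le_trans D1).
have : r * (1 + k) <= (a + e) * l * (1 + k) by rewrite ler_wpM2r//; lra.
move/le_trans; apply; rewrite mulrAC ler_wpM2r//.
have : (a + e) * k <= e by rewrite mulrC (le_trans _ ke)// ler_wpM2l ?ltW//; lra.
rewrite mulrDr mulr1; lra.
Qed.

(** By [increment_le_of_local] applied to a primitive [F] of the speed, plus a
    term [eta * t] that leaves room for the local errors: near [p] the
    pseudo-distance grows at most like [|g p| + 3 * eta / 4] and [F] at least
    like [|g p| - eta / 4]. *)
Lemma C1_length_lower_bound f c d (D : R -> R -> R) : c < d -> C1_on f c d ->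
  (forall s t, D s t = D t s) ->
  (forall r s t, r \in `[c, d] -> s \in `[c, d] -> t \in `[c, d] ->
     D r t <= D r s + D s t) ->
  (forall p, p \in `[c, d] -> exists2 delta : R, 0 < delta &
     forall t, t \in `[c, d] -> `|t - p| < delta ->
       D p t * (1 - `|f t - f p| ^+ 2 / 4) <= `|f t - f p|) ->
  ((D c d)%:E <= \int[lebesgue_measure]_(t in `[c, d]) `|derive1 f t|%:E)%E.
Proof.
move=> cd C1f Dsym Dtri Dloc.
have mf := measurable_speed cd C1f.
have [g [h [dg ch hE d1E]]] := speed_extension (ltW cd) C1f.
have -> : (\int[lebesgue_measure]_(t in `[c, d]) `|derive1 f t|%:E =
           \int[lebesgue_measure]_(t in `[c, d]) (h t)%:E)%E.
  rewrite [LHS]integral_itv_bndoo; last first.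
    apply/measurable_EFinP; apply: measurable_funS mf => //.
    exact: subset_itv_oo_cc.
  rewrite [RHS]integral_itv_bndoo; last first.
    by apply/measurable_EFinP; apply: measurable_funTS; exact: continuous_measurable_fun.
  by apply: eq_integral => t /set_mem/= /d1E ->.
have [F [dF ->]] := continuous_primitive cd ch; rewrite lee_fin.
apply/ler_addgt0Pr => e e0.
pose eta := e / (d - c).
have eta0 : 0 < eta by rewrite divr_gt0 ?subr_gt0.
pose G t := F t + eta * t.
have -> : F d - F c + e = G d - G c.
  by rewrite /G /eta; field; rewrite subr_eq0 gt_eqF.
have cin : c \in `[c, d] by rewrite in_itv/= lexx ltW.
apply: increment_le_of_local => //; first exact: ltW.
  have [delta delta0 /(_ c cin)] := Dloc c cin.
  by rewrite !subrr !normr0 expr0n mul0r subr0 mulr1; exact.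
move=> p pin; pose e1 := eta / 4.
have e10 : 0 < e1 by rewrite divr_gt0.
have [d1 d10 loc1] := Dloc p pin.
have [d2 d20 loc2] := C1_on_increment (dg p pin) e10.
have [d3 d30 loc3] := derivable_increment (dF p pin).1 e10.
have ae0 : 0 < `|g p| + eta by rewrite ltr_wpDl.
have ae10 : 0 < `|g p| + e1 by rewrite ltr_wpDl.
pose k := Num.min 1 (e1 / (`|g p| + eta)).
have k0 : 0 < k by rewrite lt_min ltr01 divr_gt0.
have k1 : k <= 1 by rewrite ge_min lexx.
have kd : k * (`|g p| + 4 * e1) <= e1.
  rewrite (_ : 4 * e1 = eta); last by rewrite /e1; field.
  by rewrite -ler_pdivlMr// ge_min lexx orbT.
exists (Num.min d1 (Num.min d2 (Num.min d3 (k / (`|g p| + e1))))).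
  by rewrite !lt_min d10 d20 d30 divr_gt0.
move=> s sin; rewrite !lt_min => /and4P[s1 s2 s3 s4].
have chord := loc1 s sin s1; have incr := loc2 s sin s2.
have rk : `|f s - f p| <= k.
  by rewrite (le_trans incr)// ltW// mulrC -ltr_pdivlMr.
have := chord_bound_rescale (normr_ge0 _) (normr_ge0 _) (normr_ge0 _) e10 k0 k1
  chord incr rk kd.
have := loc3 s s3; rewrite (dF p pin).2 (hE p pin).
have -> : 3 * e1 = eta - e1 by rewrite /e1; field.
rewrite ler_norml => /andP[F1 F2] DB; rewrite /G; clear -DB F1 F2 Dsym.
split => sp.
  rewrite Dsym; move: DB F1 F2; rewrite ler0_norm ?subr_le0// => *; lra.
move: DB F1 F2; rewrite ger0_norm ?subr_ge0// => *; lra.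
Qed.

End piece.

(** * Piecewise C1 curves *)

Section piecewise.
Context {R : realType} {V : normedModType R}.
Implicit Types (f : R -> V).

(** Induction over the pieces, from the right endpoint to the left. *)
Lemma piecewise_C1_ind (P : R -> Prop) (b : R) f :
  P b ->
  (forall a x, a < x -> x <= b -> C1_on f a x -> P x -> P a) ->
  forall a, piecewise_C1 f a b -> a <= b /\ P a.
Proof.
move=> P0 PS a [s + C1]; elim: s a C1 => [|x s IH] a C1 ps.
  by rewrite (itv_partition_nil ps); split.
have ax : a < x by case: ps => /= /andP[].
have [xb Px] : x <= b /\ P x.
  apply: IH; last exact: itv_partition_cons ps.
  by move=> i si; exact: (C1 i.+1).
split; first exact: ltW (lt_le_trans ax xb).
by apply: (PS a x) => //; exact: (C1 0%N).
Qed.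

Lemma piecewise_C1_continuous f a b : piecewise_C1 f a b ->
  {within `[a, b], continuous f}.
Proof.
move/(piecewise_C1_ind (P := fun a => {within `[a, b], continuous f})).
case=> //; first by rewrite set_itv1; exact: continuous_subspace1.
move=> {}a x ax xb fax fxb.
have -> : `[a, b]%classic = `[a, x] `|` `[x, b].
  apply/seteqP; split => t /=; rewrite !in_itv/=.
    by move=> /andP[-> ->]/=; rewrite andbT; case: (leP t x) => [|/ltW]; [left|right].
  move=> [] /andP[t1 t2]; first by rewrite t1 (le_trans t2).
  by rewrite t2 andbT (le_trans (ltW ax)).
apply: withinU_continuous => //; [exact: interval_closed|exact: interval_closed|].
exact: C1_on_continuous.
Qed.

(** The bound on each piece, the triangle inequality for [D] and the additivity of
    the integral; measurability of the speed is carried along for the latter. *)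
Lemma length_lower_bound f a b (D : R -> R -> R) : piecewise_C1 f a b ->
  (forall s t, D s t = D t s) ->
  (forall r s t, r \in `[a, b] -> s \in `[a, b] -> t \in `[a, b] ->
     D r t <= D r s + D s t) ->
  (forall p, p \in `[a, b] -> exists2 delta : R, 0 < delta &
     forall t, t \in `[a, b] -> `|t - p| < delta ->
       D p t * (1 - `|f t - f p| ^+ 2 / 4) <= `|f t - f p|) ->
  ((D a b)%:E <= curve_length f a b)%E.
Proof.
move=> fab Dsym Dtri Dloc.
pose P (x : R) := a <= x ->
  measurable_fun `[x, b] (fun t => `|derive1 f t|) /\
  ((D x b)%:E <= \int[lebesgue_measure]_(t in `[x, b]) `|derive1 f t|%:E)%E.
suff [_ /(_ (lexx a)) []] : a <= b /\ P a by [].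
have ab : a <= b.
  by have [] := piecewise_C1_ind (P := fun _ => True) I (fun _ _ _ _ _ _ => I) fab.
apply: piecewise_C1_ind fab => [_|x y xy yb fxy IH ax].
  rewrite set_itv1; split; first exact: measurable_fun_set1.
  rewrite integral_set1 lee_fin.
  have bin : b \in `[a, b] by rewrite in_itv/= ab lexx.
  have [delta delta0 /(_ b bin)] := Dloc b bin.
  by rewrite !subrr !normr0 expr0n mul0r subr0 mulr1; exact.
have sub : {subset `[x, y] <= `[a, b]}.
  move=> t; rewrite !in_itv/= => /andP[xt ty].
  by rewrite (le_trans ax xt) (le_trans ty yb).
have mxy := measurable_speed xy fxy.
have Dxy : ((D x y)%:E <= \int[lebesgue_measure]_(t in `[x, y]) `|derive1 f t|%:E)%E.
  apply: C1_length_lower_bound => //.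
    by move=> r s t /sub ? /sub ? /sub ?; exact: Dtri.
  by move=> p /sub /Dloc[delta d0 h]; exists delta => // t /sub; exact: h.
have [|myb Dyb] := IH; first exact: le_trans ax (ltW xy).
have xE : `[x, b]%classic = `[x, y] `|` `]y, b].
  by rewrite -itv_bndbnd_setU// bnd_simp ltW.
have mS : measurable_fun `]y, b] (fun t => `|derive1 f t|).
  by apply: measurable_funS myb => //; exact: subset_itv_oc_cc.
have mU : measurable_fun `[x, b] (fun t => `|derive1 f t|).
  by rewrite xE; apply/measurable_funU => //; split.
split=> //; rewrite xE ge0_integral_setU//=; last 2 first.
- by rewrite -xE; exact/measurable_EFinP.
- apply/disj_setPS => t /= []; rewrite !in_itv/= => /andP[_ ty] /andP[yt _].
  by move: (le_lt_trans ty yt); rewrite ltxx.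
(* the pieces overlap in the single point [y] *)
rewrite (@integral_itv_obnd_cbnd _ y); last exact/measurable_EFinP.
apply: le_trans (leeD Dxy Dyb); rewrite -EFinD lee_fin.
have inab t : x <= t -> t <= b -> t \in `[a, b].
  by move=> xt tb; rewrite in_itv/= tb andbT (le_trans ax).
have xb : x <= b := le_trans (ltW xy) yb.
by apply: Dtri; apply: inab => //; exact: ltW.
Qed.

End piecewise.

(** * Determinants and characteristic polynomials of endomorphisms *)

Section lfun_matrix.
Context {K : fieldType} {H : vectType K}.
Implicit Types (f g : 'End(H)).

(** The order of the factors is reversed in [mxof], which acts on row vectors. *)
Lemma lfun_det_comp f g : lfun_det (f \o g)%VF = lfun_det f * lfun_det g.
Proof.
have b := vbasisP {:H}.
by rewrite /lfun_det /lfun_mx (passmx.mxof_comp _ _ b) det_mulmx mulrC.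
Qed.

Lemma rVofZ a x : passmx.rVof (vbasis {:H}) (a *: x) =
  a *: passmx.rVof (vbasis {:H}) x.
Proof.
have rV0 : passmx.rVof (vbasis {:H}) 0 = 0 by apply/eqP; rewrite passmx.rVof_eq0 ?vbasisP.
by rewrite -[a *: x]addr0 passmx.rVof_linear rV0 addr0.
Qed.

Lemma rVof_sum (I : Type) (r : seq I) (P : pred I) (F : I -> H) :
  passmx.rVof (vbasis {:H}) (\sum_(i <- r | P i) F i) =
  \sum_(i <- r | P i) passmx.rVof (vbasis {:H}) (F i).
Proof.
apply: (big_morph (passmx.rVof (vbasis {:H}))) => [x y|].
  by rewrite -[in LHS](scale1r x) passmx.rVof_linear scale1r.
by apply/eqP; rewrite passmx.rVof_eq0 ?vbasisP.
Qed.

Lemma root_char_poly_eigenvector f (l : K) : root (lfun_char_poly f) l ->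
  exists2 y : H, y != 0 & f y = l *: y.
Proof.
rewrite /lfun_char_poly -eigenvalue_root_char => /eigenvalueP[r rf r0].
have b := vbasisP {:H}.
exists (passmx.vecof (vbasis {:H}) r); first by rewrite passmx.vecof_eq0.
apply: (can_inj (passmx.rVofK b)); rewrite -passmx.mul_mxof rf.
by rewrite rVofZ passmx.vecofK.
Qed.

Lemma char_poly_factor_root f (I : finType) (lam : I -> K) i :
  lfun_char_poly f = \prod_i ('X - (lam i)%:P) -> root (lfun_char_poly f) (lam i).
Proof.
by move=> ->; rewrite rootE horner_prod (bigD1 i)//= hornerXsubC subrr mul0r.
Qed.

(** Evaluation at 0: both sides acquire the sign [(-1) ^ N]. *)
Lemma lfun_det_prod f (lam : 'I_(\dim {:H}) -> K) :
  lfun_char_poly f = \prod_i ('X - (lam i)%:P) -> lfun_det f = \prod_i lam i.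
Proof.
move=> /(congr1 (fun p : {poly K} => p.[0])).
rewrite horner_coef0 char_poly_det horner_prod => h.
apply: (can_inj (signrMK (\dim {:H}))); rewrite -/(lfun_mx _) [LHS]h.
transitivity (\prod_(i < \dim {:H}) (-1 * lam i)).
  by apply: eq_bigr => i _; rewrite hornerXsubC sub0r mulN1r.
by rewrite big_split/= prodr_const card_ord.
Qed.

End lfun_matrix.

(** * Unitary operators *)

Section unitary_facts.
Context {R : realType} {H : vectType R[i]}.
Variable dot : {dot H for conjC}.
Implicit Types (w f : 'End(H)) (x y : H).

Lemma unitary_hnorm w x : unitary dot w -> hnorm dot (w x) = hnorm dot x.
Proof. by move=> [iw _]; rewrite /hnorm iw. Qed.

(** The norm of the difference of two points is preserved. *)
Lemma isometry_lker0 w : isometry dot dot w -> lker w == 0%VS.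
Proof.
move=> iw; apply/lker0P => x y xy; apply/eqP; rewrite -subr_eq0; apply/eqP.
apply: (@hnorm_eq0 _ _ dot).
by rewrite /hnorm -iw linearB/= xy subrr linear0l/= sqrtr0.
Qed.

Lemma unitaryVw w : unitary dot w -> (w^-1 \o w)%VF = \1%VF.
Proof. by move=> [/isometry_lker0 iw _]; exact: lker0_compVf. Qed.

Lemma unitarywV w : unitary dot w -> (w \o w^-1)%VF = \1%VF.
Proof. by move=> [/isometry_lker0 iw _]; exact: lker0_compfV. Qed.

Lemma unitaryVK w x : unitary dot w -> (w^-1)%VF (w x) = x.
Proof. by move=> uw; have := unitaryVw uw => /lfunP/(_ x); rewrite comp_lfunE id_lfunE. Qed.

Lemma unitaryKV w x : unitary dot w -> w ((w^-1)%VF x) = x.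
Proof. by move=> uw; have := unitarywV uw => /lfunP/(_ x); rewrite comp_lfunE id_lfunE. Qed.

(** In finite dimension an injective endomorphism is onto. *)
Lemma isometry_unitary w : isometry dot dot w -> unitary dot w.
Proof.
move=> iw; split => //; apply/eqP; rewrite eqEdim subvf/=.
by rewrite limg_dim_eq ?leqnn// (eqP (isometry_lker0 iw)) capv0.
Qed.

Lemma unitaryV w : unitary dot w -> unitary dot (w^-1)%VF.
Proof.
move=> uw; apply: isometry_unitary => x y.
by rewrite -{2}(unitaryKV x uw) -{2}(unitaryKV y uw) (proj1 uw).
Qed.

Lemma unitary_comp w w' : unitary dot w -> unitary dot w' -> unitary dot (w \o w')%VF.
Proof.
move=> [iw _] [iw' _]; apply: isometry_unitary => x y.
by rewrite !comp_lfunE iw iw'.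
Qed.

Lemma opnorm_comp_unitary f w : unitary dot w ->
  opnorm dot (f \o w)%VF <= opnorm dot f.
Proof.
move=> uw; apply: opnorm_le => [|x]; first exact: opnorm_ge0.
by rewrite comp_lfunE -(unitary_hnorm x uw) hnorm_le_opnorm.
Qed.

Lemma lfun_det_compV f w : unitary dot w ->
  lfun_det (f \o w^-1)%VF * lfun_det w = lfun_det f.
Proof.
move=> uw; rewrite -lfun_det_comp; congr lfun_det.
by apply/lfunP => x; rewrite !comp_lfunE (unitaryVK _ uw).
Qed.

Lemma opnorm_compV_sub1 f w : unitary dot w ->
  opnorm dot ((f \o w^-1) - \1)%VF <= opnorm dot (f - w).
Proof.
move=> uw; have -> : ((f \o w^-1) - \1)%VF = ((f - w) \o w^-1)%VF.
  apply/lfunP => x; rewrite add_lfunE opp_lfunE !comp_lfunE add_lfunE opp_lfunE.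
  by rewrite id_lfunE (unitaryKV x uw).
by apply: opnorm_comp_unitary; exact: unitaryV.
Qed.

Lemma unit_eigenvector w (l : R[i]) : root (lfun_char_poly w) l ->
  exists2 y : H, hnorm dot y = 1 & w y = l *: y.
Proof.
move=> /root_char_poly_eigenvector[y y0 wy].
have hy : 0 < hnorm dot y.
  by rewrite lt_def hnorm_ge0 andbT; apply: contra_neq y0; exact: hnorm_eq0.
exists ((hnorm dot y)^-1%:C *: y).
  by rewrite hnormZ normc_real ger0_norm ?invr_ge0 1?ltW// mulVf// gt_eqF.
by rewrite linearZ/= wy !scalerA mulrC.
Qed.

Lemma unitary_eigenvalue w (l : R[i]) :
  unitary dot w -> root (lfun_char_poly w) l -> normc l = 1.
Proof.
move=> uw /unit_eigenvector[y y1 wy].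
by rewrite -[normc l]mulr1 -y1 -hnormZ -wy unitary_hnorm.
Qed.

(** Evaluate [w - 1] at a unit eigenvector. *)
Lemma eigenvalue_near1 w (l : R[i]) : root (lfun_char_poly w) l ->
  normc (l - 1) <= opnorm dot (w - \1%VF).
Proof.
move=> /unit_eigenvector[y y1 wy].
have := hnorm_le_opnorm dot (w - \1%VF) y.
rewrite y1 mulr1; apply: le_trans.
rewrite add_lfunE opp_lfunE id_lfunE wy.
by rewrite -{2}[y]scale1r -scalerBl hnormZ y1 mulr1.
Qed.

(** The field of complex numbers is algebraically closed. *)
Lemma char_poly_split w : exists lam : 'I_(\dim {:H}) -> R[i],
  lfun_char_poly w = \prod_i ('X - (lam i)%:P).
Proof.
have [r rE] := closed_field_poly_normal (lfun_char_poly w).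
rewrite (eqP (char_poly_monic _)) scale1r in rE.
have sr : size r = \dim {:H}.
  apply/eqP; rewrite -eqSS -(size_prod_XsubC r id) -rE.
  by rewrite size_char_poly.
exists (fun i => r`_i); rewrite rE (big_nth 0) sr big_mkord.
by apply: eq_bigr.
Qed.

End unitary_facts.

(** * The angular distance on the unit sphere *)

Section sphere.
Context {R : realType} {H : vectType R[i]}.
Variable dot : {dot H for conjC}.
Implicit Types (x y z : H) (a : R).

(** The real inner product underlying the hermitian one; its angle is the
    geodesic distance on the unit sphere. *)
Definition rdot x y : R := complex.Re (dot x y).

Lemma rdotC x y : rdot x y = rdot y x.
Proof.
rewrite /rdot hermC expr0 mul1r.
by have ReC (z : R[i]) : complex.Re (conjC z) = complex.Re z; [case: z|exact: ReC].
Qed.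

Lemma rdotDl x y z : rdot (x + y) z = rdot x z + rdot y z.
Proof. by rewrite /rdot linearDl/= raddfD. Qed.

Lemma rdotZl a x y : rdot (a%:C *: x) y = a * rdot x y.
Proof.
rewrite /rdot linearZl_LR/=; case: (dot x y) => p q /=.
by rewrite mul0r subr0.
Qed.

Lemma rdotDr x y z : rdot z (x + y) = rdot z x + rdot z y.
Proof. by rewrite rdotC rdotDl !(rdotC z). Qed.

Lemma rdotZr a x y : rdot y (a%:C *: x) = a * rdot y x.
Proof. by rewrite rdotC rdotZl rdotC. Qed.

Lemma rdot_hnorm x : rdot x x = hnorm dot x ^+ 2.
Proof.
rewrite /hnorm sqr_sqrtr//.
by have := dnorm_ge0 dot x; rewrite lecE/= => /andP[].
Qed.

Lemma rdot_le x y : `|rdot x y| <= hnorm dot x * hnorm dot y.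
Proof.
exact: le_trans (normc_Re _) (normc_dot_le dot x y).
Qed.

Definition sphere_dist x y : R := acos (rdot x y).

Lemma rdot_unit x y : hnorm dot x = 1 -> hnorm dot y = 1 -> -1 <= rdot x y <= 1.
Proof. by move=> x1 y1; rewrite -ler_norml (le_trans (rdot_le x y))// x1 y1 mulr1. Qed.

Lemma sphere_distC x y : sphere_dist x y = sphere_dist y x.
Proof. by rewrite /sphere_dist rdotC. Qed.

(** With [a = <x, y>] and [b = <y, z>], the components of [x] and [z] orthogonal
    to [y] have inner product [<x, z> - a * b] and norms [sqrt (1 - a^2)] and
    [sqrt (1 - b^2)]. By Cauchy-Schwarz [<x, z>] is at least the cosine of the sum
    of the two angles. *)
Lemma sphere_dist_triangle x y z : hnorm dot x = 1 -> hnorm dot y = 1 -> hnorm dot z = 1 ->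
  sphere_dist x z <= sphere_dist x y + sphere_dist y z.
Proof.
move=> x1 y1 z1; rewrite /sphere_dist.
have xy := rdot_unit x1 y1; have yz := rdot_unit y1 z1; have xz := rdot_unit x1 z1.
have [/andP[a0 api] ca] := acos_def xy; have [/andP[b0 bpi] cb] := acos_def yz.
have [/andP[c0 cpi] cc] := acos_def xz.
have [|abpi] := leP pi (acos (rdot x y) + acos (rdot y z)); first exact: le_trans.
rewrite leNgt -ltr_cos ?in_itv/= ?c0 ?cpi ?addr_ge0 ?(ltW abpi)//.
rewrite cosD ca cb cc !sin_acos// -leNgt.
pose a := rdot x y; pose b := rdot y z; rewrite -/a -/b.
pose x' := x + (- a)%:C *: y; pose z' := z + (- b)%:C *: y.
have yy : rdot y y = 1 by rewrite rdot_hnorm y1 expr1n.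
have xx : rdot x x = 1 by rewrite rdot_hnorm x1 expr1n.
have zz : rdot z z = 1 by rewrite rdot_hnorm z1 expr1n.
have xz' : rdot x' z' = rdot x z - a * b.
  rewrite /x' /z' !(rdotDl, rdotDr, rdotZl, rdotZr) yy -/a -/b; lra.
have hx' : hnorm dot x' = Num.sqrt (1 - a ^+ 2).
  rewrite /hnorm -/(rdot _ _) /x' !(rdotDl, rdotDr, rdotZl, rdotZr) yy xx (rdotC y x) -/a.
  by congr Num.sqrt; lra.
have hz' : hnorm dot z' = Num.sqrt (1 - b ^+ 2).
  rewrite /hnorm -/(rdot _ _) /z' !(rdotDl, rdotDr, rdotZl, rdotZr) yy zz (rdotC z y) -/b.
  by congr Num.sqrt; lra.
have := rdot_le x' z'; rewrite xz' hx' hz' ler_norml => /andP[+ _]; lra.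
Qed.

(** A chord of the sphere is the chord of the circle for the same angle, so
    [arc_le_chord] applies. *)
Lemma sphere_dist_chord x y : hnorm dot x = 1 -> hnorm dot y = 1 ->
  sphere_dist x y * (1 - hnorm dot (x - y) ^+ 2 / 4) <= hnorm dot (x - y).
Proof.
move=> x1 y1; have xy := rdot_unit x1 y1.
have [/andP[a0 api] ca] := acos_def xy.
have := @arc_le_chord R (sphere_dist x y).
rewrite ger0_norm// => /(_ api).
suff -> : normc (expi (sphere_dist x y) - 1) = hnorm dot (x - y) by [].
rewrite /normc/= /sphere_dist ca subr0 sin_acos// sqr_sqrtr; last first.
  by rewrite subr_ge0 -ler_sqrt ?ler01// sqrtr_sqr sqrtr1 ler_norml.
rewrite /hnorm -/(rdot _ _); congr Num.sqrt.
have -> : - y = (- (1 : R))%:C *: y by rewrite rmorphN scaleN1r.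
rewrite !(rdotDl, rdotDr, rdotZl, rdotZr) (rdotC y x) !rdot_hnorm x1 y1.
by ring.
Qed.

End sphere.

(** * Lower bounds for lengths of unitary paths *)

Section lower_bounds.
Context {R : realType} {H : vectType R[i]}.
Variable dot : {dot H for conjC}.

Lemma within_near (V : normedModType R) (f : R -> V) a b p e :
  {within `[a, b], continuous f} -> p \in `[a, b] -> 0 < e ->
  exists2 delta : R, 0 < delta &
    forall t, t \in `[a, b] -> `|t - p| < delta -> `|f t - f p| < e.
Proof.
move=> /subspace_continuousP cf pab e0.
have /cvgrPdist_lt/(_ e e0) := cf p pab.
rewrite near_withinE => /nbhs_ballP[delta /= delta0 h]; exists delta => // t tab tp.
by rewrite distrC; apply: h => //; rewrite /ball/= distrC.
Qed.

(** The image of a vector moves on the unit sphere no faster than the path moves in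
    operator norm. Starting from [u^-1 y], where [y] is a unit eigenvector of
    [v u^-1], its image goes from [y] to [expi t *: y], at angle [|t|]. *)
Lemma eigenvalue_arg_le_length u v a b gamma (t : R) :
  unitary dot u -> unitary_path dot u v a b gamma -> `|t| <= pi ->
  root (lfun_char_poly ((v : 'End(H)) \o u^-1)%VF) (expi t) ->
  (`|t|%:E <= curve_length gamma a b)%E.
Proof.
move=> uu [ab gab ug ga gb] tpi /(unit_eigenvector dot)[y y1 vy].
pose x s : H := (gamma s : 'End(H)) ((u^-1)%VF y).
have x1 s : s \in `[a, b] -> hnorm dot (x s) = 1.
  by move=> /ug us; rewrite unitary_hnorm// unitary_hnorm//; exact: unitaryV.
have -> : `|t| = sphere_dist dot (x a) (x b).
  rewrite /x ga gb unitaryKV// -comp_lfunE vy /sphere_dist /rdot linearZr/=.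
  have -> : dot y y = 1.
    apply/eqP; rewrite eq_complex; apply/andP; split; apply/eqP.
      by rewrite -/(rdot dot y y) rdot_hnorm y1 expr1n.
    by have := dnorm_ge0 dot y; rewrite lecE/= => /andP[/eqP].
  rewrite mulr1 /=.
  have -> : cos t = cos `|t| by case: (ger0P t) => // _; rewrite cosN.
  by rewrite cosK// in_itv/= normr_ge0.
apply: (length_lower_bound (D := fun s t => sphere_dist dot (x s) (x t))) => //.
- by move=> s s'; rewrite sphere_distC.
- by move=> r s s' /x1 ? /x1 ? /x1 ?; exact: sphere_dist_triangle.
move=> p pab; exists 1 => // s sab _.
have sp := sphere_dist_chord (x1 p pab) (x1 s sab).
have d0 : 0 <= sphere_dist dot (x p) (x s).
  by rewrite acos_ge0// rdot_unit ?x1.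
have le : hnorm dot (x p - x s) <= `|gamma s - gamma p|.
  have := hnorm_le_opnorm dot (gamma p - gamma s : 'End(H)) ((u^-1)%VF y).
  rewrite (unitary_hnorm _ (unitaryV uu)) y1 mulr1 add_lfunE opp_lfunE => /le_trans; apply.
  by rewrite distrC.
apply: (le_trans _ le); apply: (le_trans _ sp).
by rewrite ler_wpM2l// lerD2l lerN2 ler_pM2r// ler_pXn2r// ?nnegrE ?hnorm_ge0//.
Qed.

(** For times [s] and [t] so close that the chord [r] is below [1 / N], the
    eigenvalues of [w = gamma t gamma(s)^-1] have small arguments [th i], each at
    most an arc of chord [r]. Their sum and [phi t - phi s] are arguments of
    [det w] that are both small, so they coincide. *)
Lemma cover_angle_le_length p q a b gamma phi : (0 < \dim {:H})%N ->
  ucover_path dot p q a b gamma phi ->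
  ((`|q.2 - p.2| / (\dim {:H})%:R)%:E <= curve_length gamma a b)%E.
Proof.
set N := \dim {:H} => N0 [ab [gab pab] ug <- <-] /=.
have N0R : 0 < N%:R :> R by rewrite ltr0n.
have N1 : 1 <= N%:R :> R by rewrite ler1n.
apply: (length_lower_bound (D := fun s t => `|phi t - phi s| / N%:R)) => //.
- by move=> s t; rewrite distrC.
- move=> r s t _ _ _; rewrite -mulrDl ler_pM2r ?invr_gt0//.
  by rewrite [leRHS]addrC -[phi t - phi r](subrKA (phi s)) ler_normD.
move=> s sab.
have [d1 d10 h1] := within_near (piecewise_C1_continuous pab) sab ltr01.
have N0V : 0 < N%:R^-1 :> R by rewrite invr_gt0.
have [d2 d20 h2] := within_near (piecewise_C1_continuous gab) sab N0V.
exists (Num.min d1 d2); first by rewrite lt_min d10 d20.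
move=> t tab; rewrite lt_min => /andP[/(h1 t tab) pt /(h2 t tab) gt].
have [/= us ds] := ug s sab; have [/= ut dt] := ug t tab.
set r := `|gamma t - gamma s| in gt *.
pose w := ((gamma t : 'End(H)) \o (gamma s : 'End(H))^-1)%VF.
have uw : unitary dot w by apply: unitary_comp => //; exact: unitaryV.
have dw : lfun_det w = expi (phi t - phi s).
  apply: (mulIf (expi_neq0 (phi s))); rewrite -expiD subrK -dt -ds.
  exact: lfun_det_compV us.
have wr : opnorm dot (w - \1%VF) <= r by exact: opnorm_compV_sub1.
have [lam lamE] := char_poly_split w.
have lamroot i := char_poly_factor_root i lamE.
have lam1 i := unitary_eigenvalue uw (lamroot i).
have /choice[th thP] : forall i, exists t, `|t| <= pi /\ expi t = lam i.
  by move=> i; have [x] := expi_surj (lam1 i); exists x.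
have r0 : 0 <= r by exact: normr_ge0.
have r1 : r < 1 by apply: (lt_le_trans gt); rewrite invf_le1.
have thr i : `|th i| * (1 - r ^+ 2 / 4) <= r.
  have [thpi thE] := thP i; have := arc_le_chord thpi.
  rewrite thE; have := le_trans (eigenvalue_near1 dot (lamroot i)) wr.
  move=> lr; move=> /le_trans/(_ lr); apply: le_trans.
  by rewrite ler_wpM2l// lerD2l lerN2 ler_pM2r// ler_pXn2r// nnegrE normc_ge0.
have sumr : `|\sum_i th i| * (1 - r ^+ 2 / 4) <= N%:R * r.
  have k0 : 0 <= 1 - r ^+ 2 / 4 by rewrite expr2; nra.
  apply: (@le_trans _ _ (\sum_i `|th i| * (1 - r ^+ 2 / 4))).
    by rewrite -mulr_suml ler_wpM2r// ler_norm_sum.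
  apply: (@le_trans _ _ (\sum_(i < \dim {:H}) r)); first by apply: ler_sum => i _.
  by rewrite sumr_const card_ord mulr_natl.
(* [r <= 1] makes the factor [1 - r^2 / 4] at least 3/4, so [|sum| <= 4/3 < 2] *)
have Nr : N%:R * r < 1 by rewrite mulrC -ltr_pdivlMr// div1r.
have sum2 : `|\sum_i th i| < 2.
  move: sumr; move: `|\sum_i _| (normr_ge0 (\sum_i th i)) => S S0.
  have : r ^+ 2 <= 1 by rewrite expr2; nra.
  by nra.
have -> : phi t - phi s = \sum_i th i.
  apply: expi_inj_small.
    have := pi_ge2 R; move: pt sum2; rewrite !ltr_norml => /andP[? ?] /andP[? ?] ?.
    by apply/andP; split; lra.
  rewrite expi_sum -dw (lfun_det_prod lamE); apply: eq_bigr => i _.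
  by have [_ ->] := thP i.
by rewrite mulrAC ler_pdivrMr// mulrC [r * _]mulrC mulrC.
Qed.

End lower_bounds.

(** * Upper bounds for lengths *)

Section lipschitz_criterion.
Context {R : realType} {V : normedModType R}.

(** A uniform linear rate replaces the limits by explicit neighbourhoods. *)
Lemma lipschitz_C1 (f g : R -> V) (a b K : R) : 0 < K ->
  (forall s t, s != t -> `|(s - t)^-1 *: (f s - f t) - g t| <= K * `|s - t|) ->
  (forall s t, `|g s - g t| <= K * `|s - t|) ->
  {within `[a, b], continuous g} /\
  (forall t, t \in `[a, b] ->
     (s - t)^-1 *: (f s - f t) @[s --> within `[a, b] t^'] --> g t).
Proof.
move=> K0 df lg; split.
  apply: continuous_subspaceT => t; apply/cvgrPdist_lt => e e0.
  apply/nbhs_ballP; exists (e / K); first by rewrite /= divr_gt0.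
  move=> s; rewrite /ball/= => ts.
  by rewrite (le_lt_trans (lg _ _))// mulrC -ltr_pdivlMr.
move=> t _; apply/cvgrPdist_lt => e e0; rewrite near_withinE.
apply/nbhs_ballP; exists (e / K); first by rewrite /= divr_gt0.
move=> s; rewrite /ball/= distrC => ts st _.
by rewrite distrC (le_lt_trans (df _ _ st))// mulrC -ltr_pdivlMr.
Qed.

End lipschitz_criterion.

Section length_upper_bound.
Context {R : realType} {V : normedModType R}.

(** On the open interval [derive1 f] is [g]; the endpoints are negligible. *)
Lemma length_le (f g : R -> V) (a b m : R) : a < b ->
  {within `[a, b], continuous g} ->
  (forall t, t \in `[a, b] ->
     (s - t)^-1 *: (f s - f t) @[s --> within `[a, b] t^'] --> g t) ->
  (forall t, `|g t| <= m) ->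
  (curve_length f a b <= (m * (b - a))%:E)%E.
Proof.
move=> ab cg dg gm.
have mfo : measurable_fun `]a, b[ (fun t => `|derive1 f t|).
  apply: measurable_funS (measurable_speed ab (ex_intro2 _ _ g cg dg)) => //.
  exact: subset_itv_oo_cc.
rewrite /curve_length integral_itv_bndoo; last exact/measurable_EFinP.
have -> : (m * (b - a))%:E = (\int[lebesgue_measure]_(t in `]a, b[) m%:E)%E.
  rewrite integral_cst//= lebesgue_measure_itv/= lte_fin ab EFinM EFinB//.
apply: ge0_le_integral => //.
- exact/measurable_EFinP.
- move=> t tab; rewrite lee_fin (C1_on_derive1 (dg t _) tab)//.
  exact: subset_itv_oo_cc.
Qed.

Lemma affine_C1 (x y a b : R) : C1_on (fun t => x + t * y) a b.
Proof.
exists (fun=> y); first exact: continuous_subspaceT (fun=> cvg_cst _).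
move=> t _; apply/cvgrPdist_lt => e e0; rewrite near_withinE.
apply/nbhs_ballP; exists 1 => //= s _ st _.
suff -> : (s - t)^-1 *: (x + s * y - (x + t * y)) = y by rewrite subrr normr0.
rewrite opprD addrACA subrr add0r -mulrBl /GRing.scale/= mulKf//.
by rewrite subr_eq0.
Qed.

Lemma C1_piecewise (W : normedModType R) (f : R -> W) a b : a < b ->
  C1_on f a b -> piecewise_C1 f a b.
Proof.
move=> ab fab; exists [:: b]; first exact: itv_partition1.
by case.
Qed.

End length_upper_bound.

(** * Orthonormal frames and diagonal operators *)

Section orthonormal_frames.
Context {R : realType} {H : vectType R[i]}.
Variable dot : {dot H for conjC}.
Local Notation n := (\dim {:H}).
Implicit Types (w f : 'End(H)) (x y : H) (e : 'I_n -> H) (c : 'I_n -> R[i]).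

Definition orthonormal_frame e := forall i j, dot (e i) (e j) = (i == j)%:R.

(** An orthonormal family of maximal size is a basis, and the inner product with
    its members picks the coordinates. *)
Lemma frame_expand e : orthonormal_frame e ->
  forall x, x = \sum_i dot x (e i) *: e i.
Proof.
move=> oe x; pose X := [tuple e i | i < n].
have XE (i : 'I_n) : X`_i = e i by rewrite -tnth_nth tnth_mktuple.
have einj : injective e.
  move=> i j eij; have := oe i j; rewrite eij oe eqxx.
  by case: eqVneq => // _ /eqP; rewrite oner_eq0.
have oX : orthonormal dot X.
  apply/orthonormalP; split; first by rewrite map_inj_uniq ?enum_uniq.
  move=> _ _ /tnthP[i ->] /tnthP[j ->]; rewrite !tnth_mktuple oe.
  by rewrite (inj_eq einj).
have bX : basis_of fullv X.
  by rewrite basisEfree (orthonormal_free oX) subvf size_tuple leqnn.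
have xE := coord_basis bX (memvf x).
rewrite {1}xE; apply: eq_bigr => i _; rewrite XE; congr (_ *: _).
rewrite [in RHS]xE linear_sumlz (bigD1 i)//= big1 ?addr0.
  by rewrite linearZl_LR/= XE oe eqxx mulr1.
by move=> j ji; rewrite linearZl_LR/= XE oe (negbTE ji) mulr0.
Qed.

Lemma frame_dot e : orthonormal_frame e ->
  forall x y, dot x y = \sum_i dot x (e i) * conjC (dot y (e i)).
Proof.
move=> oe x y; rewrite {1}(frame_expand oe x) linear_sumlz; apply: eq_bigr => i _.
by rewrite linearZl_LR/=; congr (_ * _); rewrite [LHS]hermC expr0 mul1r.
Qed.

Lemma frame_ext e : orthonormal_frame e ->
  forall x y, (forall i, dot x (e i) = dot y (e i)) -> x = y.
Proof.
move=> oe x y xy; rewrite (frame_expand oe x) (frame_expand oe y).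
by apply: eq_bigr => i _; rewrite xy.
Qed.

Lemma frame_hnorm e : orthonormal_frame e ->
  forall x, hnorm dot x ^+ 2 = \sum_i normc (dot x (e i)) ^+ 2.
Proof.
move=> oe x; rewrite -rdot_hnorm /rdot (frame_dot oe) raddf_sum/=.
apply: eq_bigr => i _; exact: Re_mul_conj.
Qed.

Lemma frame_exists : exists e, orthonormal_frame e.
Proof.
have [b [/orthonormalP[ub ob] bb]] := orthonormal_basis dot.
have sb : size b = n by rewrite (size_basis (X := in_tuple b)).
exists (fun i => b`_i) => i j; rewrite ob ?mem_nth ?sb//.
by rewrite nth_uniq ?sb// (inj_eq val_inj).
Qed.

Definition rank1 (y x : H) : H := dot x y *: y.

Fact rank1_linear y : linear (rank1 y).
Proof. by move=> a u v; rewrite /rank1 linearPl/= scalerDl scalerA. Qed.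

HB.instance Definition _ y := GRing.isLinear.Build R[i] H H _ (rank1 y) (rank1_linear y).

(** The operator with eigenvalue [c i] on [e i], written as a combination of the
    orthogonal projections on the lines of the frame. *)
Definition frame_diag e c : 'End(H) := \sum_i c i *: linfun (rank1 (e i)).

Lemma frame_diagE e c x : frame_diag e c x = \sum_i (c i * dot x (e i)) *: e i.
Proof.
rewrite /frame_diag sum_lfunE; apply: eq_bigr => i _.
by rewrite scale_lfunE lfunE/= /rank1 scalerA.
Qed.

Lemma frame_diag_dot e c x i : orthonormal_frame e ->
  dot (frame_diag e c x) (e i) = c i * dot x (e i).
Proof.
move=> oe; rewrite frame_diagE linear_sumlz (bigD1 i)//= big1 ?addr0.
  by rewrite linearZl_LR/= oe eqxx mulr1.
by move=> j ji; rewrite linearZl_LR/= oe (negbTE ji) mulr0.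
Qed.

Lemma frame_diag_eigen e c i : orthonormal_frame e -> frame_diag e c (e i) = c i *: e i.
Proof.
move=> oe; apply: (frame_ext oe) => j; rewrite frame_diag_dot// linearZl_LR/= oe.
by case: eqVneq => [->|]; rewrite ?mulr0.
Qed.

Lemma eq_frame_diag e c w : orthonormal_frame e ->
  (forall i, w (e i) = c i *: e i) -> w = frame_diag e c.
Proof.
move=> oe we; apply/lfunP => x; rewrite frame_diagE {1}(frame_expand oe x) linear_sum.
by apply: eq_bigr => i _; rewrite linearZ/= we scalerA mulrC.
Qed.

Lemma frame_diag_unitary e c : orthonormal_frame e -> (forall i, normc (c i) = 1) ->
  unitary dot (frame_diag e c).
Proof.
move=> oe c1; apply: isometry_unitary => x y; rewrite [LHS](frame_dot oe) [RHS](frame_dot oe).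
apply: eq_bigr => i _; rewrite !frame_diag_dot// rmorphM mulrACA.
by rewrite mul_conj_unit// mul1r.
Qed.

Lemma frame_diag_opnorm e c m : orthonormal_frame e -> 0 <= m ->
  (forall i, normc (c i) <= m) -> opnorm dot (frame_diag e c) <= m.
Proof.
move=> oe m0 cm; apply: opnorm_le => // x.
rewrite -(@ler_pXn2r _ 2)// ?nnegrE ?mulr_ge0 ?hnorm_ge0//.
rewrite exprMn !(frame_hnorm oe) mulr_sumr; apply: ler_sum => i _.
rewrite frame_diag_dot// normcM exprMn ler_wpM2r ?sqr_ge0//.
by rewrite ler_pXn2r ?nnegrE// normc_ge0.
Qed.

(** If [S] has the coordinates of the frame as rows and [M] is the matrix of the
    operator, then [S *m M] is a diagonal matrix times [S]; the same relation for
    the characteristic matrices gives the determinant, as [S] is invertible. *)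
Lemma frame_diag_char_poly e c : orthonormal_frame e ->
  lfun_char_poly (frame_diag e c) = \prod_i ('X - (c i)%:P).
Proof.
move=> oe; pose b := vbasis {:H}; have bb : basis_of {:H} b := vbasisP {:H}.
pose M := lfun_mx (frame_diag e c).
pose S := \matrix_(i < n) passmx.rVof b (e i).
(* the inverse of [S]: the expansions of the vectors of [b] in the frame *)
pose T := \matrix_(j < n, i < n) dot (b`_j) (e i).
have TS : T *m S = 1%:M.
  apply/row_matrixP => j; rewrite row_mul mulmx_sum_row row1 -(passmx.rVofE bb).
  rewrite [in RHS](frame_expand oe b`_j) rVof_sum.
  by apply: eq_bigr => i _; rewrite rVofZ !mxE rowK.
have SM : S *m M = diag_mx (\row_i c i) *m S.
  apply/row_matrixP => i; rewrite row_mul.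
  have -> : row i (diag_mx (\row_i c i) *m S) = c i *: row i S.
    by apply/rowP => j; rewrite mul_diag_mx !mxE.
  rewrite !rowK.
  by rewrite passmx.mul_mxof passmx.rVofK// frame_diag_eigen// rVofZ.
have /mulmx1_unit[_ uS] := TS.
rewrite /lfun_char_poly -/M /char_poly.
have polyM (A B : 'M[R[i]]_n) : map_mx polyC (A *m B) = map_mx polyC A *m map_mx polyC B.
  exact: map_mxM.
have SX : map_mx polyC S *m char_poly_mx M =
    char_poly_mx (diag_mx (\row_i c i)) *m map_mx polyC S.
  by rewrite /char_poly_mx mulmxBr mulmxBl -!polyM SM scalar_mxC.
have dS : \det (map_mx polyC S) != 0.
  by rewrite det_map_mx polyC_eq0 -unitfE -unitmxE.
have := congr1 determinant SX; rewrite !det_mulmx mulrC => /(mulIf dS) ->.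
rewrite -/(char_poly _) char_poly_trig ?diag_mx_is_trig//.
by apply: eq_bigr => i _; rewrite !mxE eqxx mulr1n.
Qed.

(** The matrix of [w] in any orthonormal frame is unitary, hence normal, so the
    spectral theorem for normal matrices diagonalises it by a unitary matrix,
    whose rows are the coordinates of the new frame. *)
Lemma spectral_frame w : unitary dot w ->
  exists e (d : 'I_n -> R[i]), orthonormal_frame e /\ forall i, w (e i) = d i *: e i.
Proof.
move=> [iw _]; have [b ob] := frame_exists.
pose W := \matrix_(i, j) dot (w (b i)) (b j).
have WW : W *m map_mx conjC W^T = 1%:M.
  apply/matrixP => i j; rewrite !mxE -ob -iw [RHS](frame_dot ob).
  by apply: eq_bigr => k _; rewrite !mxE.
have /orthomx_spectralP WE : W \is normalmx.
  by apply/normalmxP; rewrite WW (mulmx1C WW).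
set P := spectralmx W in WE; pose d := spectral_diag W.
have PW : P *m W = diag_mx d *m P.
  by rewrite {1}WE !mulmxA mulmxV ?spectral_unit// mul1mx.
(* the rows of [P] are the coordinates of the eigenvectors *)
pose e i := \sum_k P i k *: b k.
have eb i k : dot (e i) (b k) = P i k.
  rewrite linear_sumlz (bigD1 k)//= big1 ?addr0.
    by rewrite linearZl_LR/= ob eqxx mulr1.
  by move=> l lk; rewrite linearZl_LR/= ob (negbTE lk) mulr0.
exists e, (d 0); split.
  move=> i j; rewrite (frame_dot ob).
  have /unitarymxP/matrixP/(_ i j) := spectral_unitarymx W; rewrite !mxE => <-.
  by apply: eq_bigr => k _; rewrite !eb !mxE.
move=> i; apply: (frame_ext ob) => l.
rewrite linearZl_LR/= eb linear_sum linear_sumlz.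
have /matrixP/(_ i l) := PW; rewrite mul_diag_mx !mxE => <-.
by apply: eq_bigr => k _; rewrite linearZ linearZl_LR/= !mxE.
Qed.

(** The eigenvalues produced by the spectral theorem are those given, up to a
    permutation of the frame. *)
Lemma unitary_frame_diag w (lam : 'I_n -> R[i]) : unitary dot w ->
  lfun_char_poly w = \prod_i ('X - (lam i)%:P) ->
  exists2 e, orthonormal_frame e & w = frame_diag e lam.
Proof.
move=> uw wlam; have [e [d [oe we]]] := spectral_frame uw.
have := frame_diag_char_poly d oe; rewrite -(eq_frame_diag oe we) wlam.
have prodE (c : 'I_n -> R[i]) : \prod_i ('X - (c i)%:P) =
    \prod_(z <- [tuple c i | i < n]) ('X - z%:P).
  by rewrite big_tuple; apply: eq_bigr => i _; rewrite tnth_mktuple.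
rewrite !prodE => /prod_XsubC_eq/tuple_permP[s sE].
have lamE i : lam i = d (s i).
  have /(congr1 (fun t : seq _ => t`_i)) := sE.
  by rewrite -!tnth_nth !tnth_mktuple.
exists (fun i => e (s i)); first by move=> i j; rewrite oe (inj_eq perm_inj).
apply: eq_frame_diag => [i j|i]; first by rewrite oe (inj_eq perm_inj).
by rewrite we lamE.
Qed.

End orthonormal_frames.

(** * The path of diagonal rotations *)

Section one_parameter_path.
Context {R : realType} {H : vectType R[i]}.
Variable dot : {dot H for conjC}.
Local Notation n := (\dim {:H}).
Variables (e : 'I_n -> H) (oe : orthonormal_frame dot e).
Variables (u : 'End(H)) (uu : unitary dot u) (theta : 'I_n -> R).
Implicit Types (c : 'I_n -> R[i]).

(** Typed in the normed space of operators, in which the paths are differentiated. *)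
Definition frame_op c : endop dot := (frame_diag dot e c \o u)%VF.

Lemma frame_opB c c' : frame_op c - frame_op c' = frame_op (fun i => c i - c' i).
Proof.
apply/lfunP => x; rewrite add_lfunE opp_lfunE !comp_lfunE !frame_diagE -sumrB.
by apply: eq_bigr => i _; rewrite -scalerBl mulrBl.
Qed.

Lemma frame_opZ (a : R) c : a *: frame_op c = frame_op (fun i => a%:C * c i).
Proof.
apply/lfunP => x; rewrite scale_lfunE !comp_lfunE !frame_diagE scaler_sumr.
by apply: eq_bigr => i _; rewrite scalerA mulrA.
Qed.

Lemma frame_op_norm c (m : R) : 0 <= m -> (forall i, normc (c i) <= m) ->
  `|frame_op c| <= m.
Proof.
move=> m0 cm; apply: le_trans (frame_diag_opnorm oe m0 cm).
exact: opnorm_comp_unitary.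
Qed.

Definition rotation (t : R) : endop dot := frame_op (fun i => expi (t * theta i)).
Definition rotation' (t : R) : endop dot :=
  frame_op (fun i => 'i * (theta i)%:C * expi (t * theta i)).

Let m := max_abs theta.

Lemma normc_itheta i : normc ('i * (theta i)%:C) = `|theta i|.
Proof.
rewrite normcM /normc/= !expr0n expr1n add0r addr0 sqrtr1 mul1r.
exact: sqrtr_sqr.
Qed.

(** The difference quotient minus the derivative is again diagonal in the frame,
    with entries [a * E * (expi x - 1 - 'i * x)] for [x = (s - t) * theta i],
    [a = 1 / (s - t)] and [|E| = 1]. *)
Lemma rotation_deriv s t : s != t ->
  `|(s - t)^-1 *: (rotation s - rotation t) - rotation' t| <= (2 * m ^+ 2 + 1) * `|s - t|.
Proof.
move=> st; have st0 : s - t != 0 by rewrite subr_eq0.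
rewrite frame_opB frame_opZ frame_opB; apply: frame_op_norm => [|i].
  by rewrite mulr_ge0// addr_ge0// mulr_ge0// sqr_ge0.
have -> : ((s - t)^-1)%:C * (expi (s * theta i) - expi (t * theta i)) -
    'i * (theta i)%:C * expi (t * theta i) =
    ((s - t)^-1)%:C * expi (t * theta i) *
      (expi ((s - t) * theta i) - 1 - 'i * ((s - t) * theta i)%:C).
  have -> : expi (s * theta i) = expi (t * theta i) * expi ((s - t) * theta i).
    by rewrite -expiD -mulrDl addrC subrK.
  have : ((s - t)^-1)%:C * (s - t)%:C = 1 :> R[i] by rewrite -rmorphM mulVf.
  have -> : ((s - t) * theta i)%:C = (s - t)%:C * (theta i)%:C by exact: rmorphM.
  move: (expi (t * theta i)) (expi ((s - t) * theta i)) ((s - t)^-1)%:C (s - t)%:C.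
  move: (theta i)%:C => th E F a b ab.
  transitivity (a * E * (F - 1) - a * b * ('i * th * E)); last by ring.
  by rewrite ab; ring.
rewrite !normcM normc_expi mulr1.
have -> : normc ((s - t)^-1)%:C = `|s - t|^-1.
  by rewrite normc_real normfV.
rewrite mulrC ler_pdivrMr ?normr_gt0//; apply: (le_trans (expi_taylor1 _)).
rewrite -mulrA -expr2 real_normK ?num_real// exprMn mulrCA mulrC.
rewrite ler_wpM2r ?sqr_ge0//.
have : theta i ^+ 2 <= m ^+ 2.
  by rewrite -(real_normK (num_real (theta i))) ler_pXn2r ?nnegrE ?max_abs_ge0// le_max_abs.
lra.
Qed.

(** The constant is the one of [rotation_deriv], so that [lipschitz_C1] applies. *)
Lemma rotation'_lipschitz s t :
  `|rotation' s - rotation' t| <= (2 * m ^+ 2 + 1) * `|s - t|.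
Proof.
rewrite frame_opB; apply: frame_op_norm => [|i].
  by rewrite mulr_ge0// addr_ge0// mulr_ge0// sqr_ge0.
rewrite -mulrBr normcM normc_itheta.
have := expi_lipschitz (s * theta i) (t * theta i).
rewrite -mulrBl normrM => h; have th := le_max_abs theta i; have m0 := max_abs_ge0 theta.
apply: (@le_trans _ _ (m * (`|s - t| * m))).
  by apply: ler_pM; rewrite ?normc_ge0// (le_trans h)// ler_wpM2l.
rewrite mulrCA mulrC ler_wpM2r//.
have := sqr_ge0 m; rewrite expr2; lra.
Qed.

Lemma rotation'_norm t : `|rotation' t| <= m.
Proof.
apply: frame_op_norm => [|i]; first exact: max_abs_ge0.
by rewrite normcM normc_itheta normc_expi mulr1 le_max_abs.
Qed.

Lemma rotation_unitary t : unitary dot (rotation t).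
Proof.
apply: unitary_comp => //; apply: frame_diag_unitary => // i.
exact: normc_expi.
Qed.

Lemma rotation_det t :
  lfun_det (rotation t) = expi (t * \sum_i theta i) * lfun_det u.
Proof.
rewrite lfun_det_comp; congr (_ * _).
rewrite (lfun_det_prod (frame_diag_char_poly _ oe)) mulr_sumr expi_sum.
by [].
Qed.

Lemma rotation0 : rotation 0 = u.
Proof.
apply/lfunP => x; rewrite comp_lfunE frame_diagE [RHS](frame_expand oe).
by apply: eq_bigr => i _; rewrite mul0r expi0 mul1r.
Qed.

(** The path of rotations, lifted by the angle [phi + t * \sum_i theta i], has
    speed at most [max_abs theta] on the unit interval. *)
Lemma rotation_dist_le v (phi psi : R) : ucover dot (u, phi) ->
  psi = phi + \sum_i theta i ->
  v = (frame_diag dot e (fun i => expi (theta i)) \o u)%VF ->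
  (ucover_dist dot (u, phi) (v, psi) <= m%:E)%E.
Proof.
move=> [_ /= detu] psiE vE.
have K0 : 0 < 2 * m ^+ 2 + 1 by rewrite ltr_wpDl// mulr_ge0// sqr_ge0.
have [c1 c2] := lipschitz_C1 0 1 K0 rotation_deriv rotation'_lipschitz.
have := length_le ltr01 c1 c2 rotation'_norm; rewrite subr0 mulr1.
apply: le_trans; apply: ereal_inf_lbound.
exists 0, 1, rotation, (fun t => phi + t * \sum_i theta i); split => //; split => //.
- split; apply: C1_piecewise => //; first by exists rotation'.
  exact: affine_C1.
- move=> t _; split => /=; first exact: rotation_unitary.
  by rewrite rotation_det detu -expiD addrC.
- by rewrite rotation0 mul0r addr0.
- rewrite mul1r -psiE vE; congr pair; apply/lfunP => x.
  rewrite !comp_lfunE !frame_diagE; apply: eq_bigr => i _.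
  by rewrite mul1r.
Qed.

End one_parameter_path.

(** * The theorem *)

Theorem proposition3p2 (R : realType) (N : nat) (hN : (1 <= N)%N)
    (H : vectType R[i]) (dot : {dot H for conjC}) (dimH : \dim {:H} = N)
    (u v : 'End(H)) (phi psi : R)
    (hu : ucover dot (u, phi)) (hv : ucover dot (v, psi))
    (lam : 'I_N -> R[i])
    (hlam : lfun_char_poly (v \o u^-1)%VF = \prod_(i < N) ('X - (lam i)%:P)) :
  exists m : R,
    [/\ is_minimum [set max_abs theta | theta in angle_lifts lam (psi - phi)] m,
        (ucover_dist dot (u, phi) (v, psi) <= (pi / (2 * N%:R))%:E)%E ->
          ucover_dist dot (u, phi) (v, psi) = unitary_dist dot u v /\
          unitary_dist dot u v = m%:E
      & ((`|psi - phi| / N%:R)%:E <= ucover_dist dot (u, phi) (v, psi))%E /\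
        (ucover_dist dot (u, phi) (v, psi)
           <= (`|psi - phi| / N%:R + 2 * pi)%:E)%E].
Proof.
subst N; set N := \dim {:H} in lam hlam hN *.
have N0R : 0 < N%:R :> R by rewrite ltr0n.
have [/= uu du] := hu; have [/= uv dv] := hv.
pose w := (v \o u^-1)%VF.
have uw : unitary dot w by apply: unitary_comp => //; exact: unitaryV.
have lamroot i := char_poly_factor_root i hlam.
have lam1 i := unitary_eigenvalue uw (lamroot i).
have prodlam : \prod_i lam i = expi (psi - phi).
  rewrite -(lfun_det_prod hlam); apply: (mulIf (expi_neq0 phi)).
  by rewrite -expiD subrK -dv -du; exact: lfun_det_compV uu.
have [th0 th0l th0mean] := lifts_near_mean hN lam1 prodlam.
have [m mmin] : exists m : R,
    is_minimum [set max_abs theta | theta in angle_lifts lam (psi - phi)] m.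
  by apply: min_max_abs; exists th0.
(* the diagonalisation turns an optimal choice of arguments into a path *)
have [[thm [thml thms] thmm] mle] := mmin.
have [e oe wE] := unitary_frame_diag uw hlam.
have up : (ucover_dist dot (u, phi) (v, psi) <= m%:E)%E.
  rewrite -thmm; apply: (rotation_dist_le oe) => //.
    by rewrite thms addrC subrK.
  have -> : (fun i => expi (thm i)) = lam by apply/funext => i; exact: thml.
  rewrite -wE; apply/lfunP => x.
  by rewrite !comp_lfunE (unitaryVK x uu).
have low : ((`|psi - phi| / N%:R)%:E <= ucover_dist dot (u, phi) (v, psi))%E.
  apply: le_ereal_inf_tmp => _ [a [b [gamma [ph [pth ->]]]]].
  exact: cover_angle_le_length hN pth.
exists m; split => //; last first.
  split => //; apply: (le_trans up); rewrite lee_fin.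
  apply: (@le_trans _ _ (max_abs th0)); first by apply: mle; exists th0.
  have p0 : 0 < pi :> R := pi_gt0 R.
  apply: max_abs_le => [|i]; first by rewrite addr_ge0 ?divr_ge0 ?mulr_ge0// ltW.
  have := th0mean i; rewrite -{2}(ger0_norm (ltW N0R)) -normf_div => h.
  by rewrite -[th0 i](subrK ((psi - phi) / N%:R)) (le_trans (ler_normD _ _))// addrC lerD2l.
move=> small.
have dle : (unitary_dist dot u v <= ucover_dist dot (u, phi) (v, psi))%E.
  apply: le_ereal_inf => _ [a [b [gamma [ph [[ab [gab _] ug [ga _] [gb _]] ->]]]]].
  exists a, b, gamma; split => //; split => // t /ug[].
  by [].
have /choice[arg argP] : forall i, exists t, `|t| <= pi /\ expi t = lam i.
  by move=> i; have [x] := expi_surj (lam1 i); exists x.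
have argd i : (`|arg i|%:E <= unitary_dist dot u v)%E.
  apply: le_ereal_inf_tmp => _ [a [b [gamma [pth ->]]]].
  have [argpi argE] := argP i.
  by apply: (eigenvalue_arg_le_length uu pth argpi); rewrite argE; exact: lamroot.
have argsmall i : `|arg i| <= pi / (2 * N%:R).
  by rewrite -lee_fin (le_trans (argd i))// (le_trans dle).
(* both sums have absolute value at most [pi / 2], so they agree *)
have argl : angle_lifts lam (psi - phi) arg.
  split=> [i|]; first by have [] := argP i.
  have p0 : 0 < pi :> R := pi_gt0 R.
  have s1 : `|\sum_i arg i| <= pi / 2.
    apply: (le_trans (ler_norm_sum _ _ _)).
    apply: (@le_trans _ _ (\sum_(i < N) pi / (2 * N%:R))); first exact: ler_sum.
    rewrite sumr_const card_ord -[leLHS]mulr_natr invfM mulrA divfK//.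
    by rewrite gt_eqF.
  have s2 : `|psi - phi| <= pi / 2.
    have := le_trans low small; rewrite lee_fin ler_pdivrMr//.
    by rewrite invfM mulrA divfK// gt_eqF.
  apply: expi_inj_small; first by rewrite (le_lt_trans (ler_normB _ _))//; lra.
  by rewrite expi_sum -prodlam; apply: eq_bigr => i _; have [] := argP i.
have mM : m <= max_abs arg by apply: mle; exists arg.
have md : (m%:E <= unitary_dist dot u v)%E.
  have [i _ maxE] := @eq_bigmax _ _ _ 0 (Ordinal hN) predT (fun i => `|arg i|)
    isT (fun i _ => normr_ge0 (arg i)).
  by rewrite (le_trans _ (argd i))// lee_fin -[leRHS]maxE.
have dm : (unitary_dist dot u v <= m%:E)%E := le_trans dle up.
split; apply/eqP; rewrite eq_le.
  by rewrite dle andbT (le_trans up).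
by rewrite dm md.
Qed.
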